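(* Let $X$ be a proper $\mathrm{CAT}(0)$-space such that the space of directions $\Sigma_pX$ is compact for every $p \in X$, and let $f$ be a parabolic isometry of $X$. Let $X_f(\infty) \subset X(\infty)$ be the set of fixed points of $f$ in the ideal boundary. Then, with respect to the Tits metric $Td$, $\operatorname{rad} X_f(\infty) \le \pi/2$. In particular, $X_f(\infty)$ is contractible (with respect to the topology induced by $Td$).
   Context: A metric space is proper if every closed bounded subset is compact. For $p \in X$, $\Sigma_p^*X$ is the set of minimizing geodesics from $p$ modulo the relation $\angle_p = 0$, where $\angle_p$ is the (Alexandrov) angle at $p$; the space of directions $\Sigma_pX$ is the $\angle_p$-completion of $\Sigma_p^*X$. An isometry $f$ of a complete $\mathrm{CAT}(0)$-space is elliptic if it has a fixed point in $X$; hyperbolic if there is a geodesic line in $X$ on which $f$ acts by a non-trivial translation; parabolic if it is neither elliptic nor hyperbolic (equivalently, the displacement function $d_f(p) = d(p,f(p))$ does not attain its infimum in $X$). The ideal boundary $X(\infty)$ is the set of asymptotic classes of rays $[0,\infty) \to X$ (two rays are asymptotic if they stay at bounded distance); isometries of $X$ act on it. For $x,y \in X(\infty)$, $\angle(x,y) := \sup_{p \in X} \angle_p(x,y)$, where $\angle_p(x,y)$ is the angle at $p$ between the unique rays from $p$ to $x$ and from $p$ to $y$. The Tits metric $Td$ is the interior (length) metric on $X(\infty)$ induced from $\angle$; it may take the value $\infty$. For a metric space $A$ with metric $d$, $\operatorname{rad} A := \inf_{x \in A} \sup_{y \in A} d(x,y)$; for $A \subset X(\infty)$ this is always taken with respect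 to $Td$. *)

(* Defs.v *)
From HB Require Import structures.
From mathcomp Require Import all_boot all_order all_algebra.
From mathcomp Require Import all_classical all_reals all_analysis.

Set Implicit Arguments.
Unset Strict Implicit.
Unset Printing Implicit Defensive.

Import Order.TTheory GRing.Theory Num.Theory.
Import numFieldNormedType.Exports.

Local Open Scope classical_set_scope.
Local Open Scope ring_scope.

(* Quotient of the subset D of T by e, as a set of classes; it is only used
   for relations e that are equivalences on D. *)
Section Quotient.
Context {T : Type}.

Definition class_in (D : set T) (e : T -> T -> Prop) (x : T) : set T :=
  [set y | D y /\ e x y].

Definition quotient_set (D : set T) (e : T -> T -> Prop) : Type :=
  set_type [set class_in D e x | x in D].

Definition class_rep (D : set T) (e : T -> T -> Prop)
    (A : quotient_set D e) : T :=
  s2val (cid2 (set_valP A)).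

End Quotient.

(* The type T with the topology whose open sets are the unions of balls
   {y | d x y < r}. *)
Definition dist_space {R : realType} {T : Type} (d : T -> T -> \bar R) : Type :=
  T.

Section DistTopology.
Context {R : realType} {T : Type} (d : T -> T -> \bar R).

HB.instance Definition _ := gen_eqMixin (dist_space d).
HB.instance Definition _ := gen_choiceMixin (dist_space d).

Definition dist_open : set_system (dist_space d) :=
  [set U | forall x, U x ->
     exists2 r : R, 0 < r & forall y, (d x y < r%:E)%E -> U y].

Let dist_openT : dist_open setT.
Proof. by move=> x _; exists 1. Qed.

Let dist_openI : setI_closed dist_open.
Proof.
move=> U V oU oV x [/oU [r r0 rU] /oV [s s0 sV]].
exists (Num.min r s) => [|y]; first by rewrite lt_min r0 s0.
rewrite EFin_min lt_min => /andP[xyr xys].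
by split; [exact: rU|exact: sV].
Qed.

Let dist_open_bigU (I : Type) (F : I -> set (dist_space d)) :
  (forall i, dist_open (F i)) -> dist_open (\bigcup_i F i).
Proof.
move=> oF x [i _ /oF [r r0 rF]]; exists r => // y xyr.
by exists i => //; exact: rF.
Qed.

HB.instance Definition _ := isOpenTopological.Build (dist_space d)
  dist_openT dist_openI dist_open_bigU.

End DistTopology.

(* The completion of the metric space (T, d): Cauchy sequences modulo
   lim d (u n) (v n) = 0. *)
Section Completion.
Context {R : realType} {T : Type} (d : T -> T -> R).

Definition cauchy_seqs : set (nat -> T) :=
  [set u | forall e : R, 0 < e ->
     exists N, forall m n, (N <= m)%N -> (N <= n)%N -> d (u m) (u n) < e].

Definition seq_dist (u v : nat -> T) : R := limn (fun n => d (u n) (v n)).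

Definition completion : Type :=
  quotient_set cauchy_seqs (fun u v => seq_dist u v = 0).

Definition completion_dist (a b : completion) : R :=
  seq_dist (class_rep a) (class_rep b).

End Completion.

Section LengthMetric.
Context {R : realType} {T : Type} (d : T -> T -> R).

Definition path_length (g : R -> T) : \bar R :=
  ereal_sup [set (\sum_(i < size s)
      d (g (nth 0 (0 :: s) i)) (g (nth 0 s i)))%:E | s in itv_partition 0 1].

(* The infimum of the lengths of the paths that are continuous for d; +oo if
   there is no such path. *)
Definition length_metric (x y : T) : \bar R :=
  ereal_inf [set path_length g | g in
    [set g | {within `[0, 1], continuous
                (g : R -> dist_space (fun a b => (d a b)%:E))} /\
             g 0 = x /\ g 1 = y]].

End LengthMetric.

Definition metric_rad {R : realType} {T : Type} (d : T -> T -> \bar R)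
    (A : set T) : \bar R :=
  ereal_inf [set ereal_sup [set d x y | y in A] | x in A].

(* The subspace A of T is contractible. *)
Definition contractible (R : realType) (T : topologicalType) (A : set T) :
    Prop :=
  exists (x0 : T) (H : R * T -> T),
    [/\ A x0,
        {within `[0, 1] `*` A, continuous H},
        forall t x, t \in `[0, 1] -> A x -> A (H (t, x)),
        forall x, A x -> H (0, x) = x &
        forall x, A x -> H (1, x) = x0].

Section MetricSpaces.
Context {R : realType} (X : metricType R).
Implicit Types (p q : X) (c : R -> X) (f : X -> X).

Definition metric_bounded (A : set X) : Prop :=
  exists M : R, forall x y, A x -> A y -> mdist x y <= M.

Definition proper_space : Prop :=
  forall A : set X, closed A -> metric_bounded A -> compact A.

(* Curves are total functions R -> X; only their values on the relevant
   interval matter. *)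
Definition isometric_on (I : set R) c : Prop :=
  forall s t, I s -> I t -> mdist (c s) (c t) = `|s - t|.

Definition geodesic_between p q c : Prop :=
  [/\ isometric_on `[0, mdist p q] c, c 0 = p & c (mdist p q) = q].

Definition geodesic_space : Prop :=
  forall p q, exists c, geodesic_between p q c.

Definition plane_dist (u v : R * R) : R :=
  Num.sqrt ((u.1 - v.1) ^+ 2 + (u.2 - v.2) ^+ 2).

(* A triangle has vertices v i and sides c i from v i to v (i + 1), with i
   taken modulo 3; w is a comparison triangle in the Euclidean plane. *)
Definition CAT0 : Prop :=
  geodesic_space /\
  forall (v : 'I_3 -> X) (c : 'I_3 -> R -> X) (w : 'I_3 -> R * R),
    (forall i, geodesic_between (v i) (v (i + 1)) (c i)) ->
    (forall i, plane_dist (w i) (w (i + 1)) = mdist (v i) (v (i + 1))) ->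
    forall (i j : 'I_3) (s t : R) (a b : R * R),
      s \in `[0, mdist (v i) (v (i + 1))] ->
      t \in `[0, mdist (v j) (v (j + 1))] ->
      plane_dist (w i) a = s ->
      plane_dist a (w (i + 1)) = mdist (v i) (v (i + 1)) - s ->
      plane_dist (w j) b = t ->
      plane_dist b (w (j + 1)) = mdist (v j) (v (j + 1)) - t ->
      mdist (c i s) (c j t) <= plane_dist a b.

Definition comparison_angle p x y : R :=
  acos ((mdist p x ^+ 2 + mdist p y ^+ 2 - mdist x y ^+ 2) /
        (2 * mdist p x * mdist p y)).

(* The Alexandrov angle at p of two curves issuing from p, the upper limit of
   comparison angles as both parameters tend to 0 from the right. *)
Definition angle p c c' : R :=
  fine (limf_esup (fun st : R * R => (comparison_angle p (c st.1) (c' st.2))%:E)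
                  (filter_prod (0 : R)^'+ (0 : R)^'+)).

(* Nonconstant minimizing geodesics from p, as pairs (length, curve). *)
Definition geodesics_from p : set (R * (R -> X)) :=
  [set g | [/\ 0 < g.1, isometric_on `[0, g.1] g.2 & g.2 0 = p]].

Definition geodesic_directions p : Type :=
  quotient_set (geodesics_from p) (fun g h => angle p g.2 h.2 = 0).

Definition direction_angle p (a b : geodesic_directions p) : R :=
  angle p (class_rep a).2 (class_rep b).2.

Definition space_of_directions p : Type :=
  dist_space (fun a b : completion (@direction_angle p) =>
    (completion_dist a b)%:E).

HB.instance Definition _ p := Topological.on (space_of_directions p).

Definition is_isometry f : Prop :=
  bijective f /\ forall x y, mdist (f x) (f y) = mdist x y.

Definition elliptic f : Prop := exists p, f p = p.

Definition hyperbolic f : Prop :=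
  exists c, isometric_on setT c /\
    exists2 a : R, a != 0 & forall t, f (c t) = c (t + a).

Definition parabolic f : Prop := ~ elliptic f /\ ~ hyperbolic f.

Definition rays : set (R -> X) := [set c | isometric_on `[0, +oo[ c].

Definition asymptotic c c' : Prop :=
  exists M : R, forall t, 0 <= t -> mdist (c t) (c' t) <= M.

Definition ideal_boundary : Type := quotient_set rays asymptotic.

(* f acts on classes of rays by postcomposition. Writing f \o c here would add
   a universe constraint that makes it impossible to load the ring and lra
   tactics of algebra-tactics together with this file. *)
Definition ideal_fixed_points f : set ideal_boundary :=
  [set x | [set (fun t => f (c t)) | c in val x] = val x].

(* In a complete CAT(0)-space there is a ray from p in each class x, unique on
   [0, +oo[; the constant curve is a dummy default. *)
Definition ray_to p (x : ideal_boundary) : R -> X :=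
  xget (fun=> p) [set c | val x c /\ c 0 = p].

Definition ideal_angle (x y : ideal_boundary) : R :=
  sup [set angle p (ray_to p x) (ray_to p y) | p in [set: X]].

Definition Td : ideal_boundary -> ideal_boundary -> \bar R :=
  length_metric ideal_angle.

End MetricSpaces.

(* Main.v *)
Require Import Defs.
From mathcomp Require Import all_boot all_order all_algebra.
From mathcomp Require Import all_classical all_reals all_analysis.
From mathcomp Require Import ring lra.
Import Order.TTheory GRing.Theory Num.Theory.
Import numFieldNormedType.Exports.
Local Open Scope classical_set_scope.
Local Open Scope ring_scope.

Set Implicit Arguments.
Unset Strict Implicit.
Unset Printing Implicit Defensive.

(** A parabolic isometry f has a convex displacement function that does not
attain its infimum m. Let p be a base point and u n its projection to the convex
set where the displacement is at most m + 1 / (n + 1). The u n leave every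
bounded set (escaping_projections): at a limit point the displacement
would attain its infimum, and then f would be elliptic or would have an axis
(attained_displacement). Let x be a limit of the u n in the ideal boundary.
It is fixed because the u n are moved by bounded distances.

Let y be another fixed point at infinity. The displacement does not increase
along a ray to y, so the ray from u n to y stays in the convex set on which u n
is the projection of p. It therefore makes at u n an angle of at least pi / 2
with the direction of p, and by the quadrilateral inequality p sees u n and the
points of its own ray to y under comparison angles of at most pi / 2. In the
limit the rays from p to x and y are at distance at most sqrt 2 times t at time t
(parabolic_center).

Two estimates relate such chords to the Tits metric. Let c and c' be the rays
from p to x and y, and let x_s be the limit as n tends to infinity of the points
that divide the segment between c n and c' n in the ratio s : 1 - s. The s -> x_s
is a path from x to y. Comparison angles at p add up superadditively along a
segment (planar_angle_superadditive), so the length of this path is at most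
the limit of the comparison angles of c n and c' n (Td_le); for a chord sqrt 2
this is pi / 2, which bounds the radius. Conversely, points at a small angle
have a small chord (small_ideal_angle_chord), so small Tits balls are small
for chords too.

The same paths contract the fixed point set to x. They consist of fixed points
(join_fixed), as the displacement is convex along segments, and they depend
continuously on y (join_chord), as the distance between two segments is
convex and the dividing points stay at distance at least n / 4 from p. *)

(** * Comparison triangles in the plane *)

Section Plane.
Context {R : realType}.
Implicit Types u v : R * R.

Lemma plane_dist_ge0 u v : 0 <= plane_dist u v.
Proof. exact: sqrtr_ge0. Qed.

Lemma sqr_plane_dist u v :
  plane_dist u v ^+ 2 = (u.1 - v.1) ^+ 2 + (u.2 - v.2) ^+ 2.
Proof. by rewrite sqr_sqrtr// addr_ge0// sqr_ge0. Qed.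

Lemma plane_distE u v a : 0 <= a ->
  (u.1 - v.1) ^+ 2 + (u.2 - v.2) ^+ 2 = a ^+ 2 -> plane_dist u v = a.
Proof. by move=> a0 e; rewrite /plane_dist e sqrtr_sqr ger0_norm. Qed.

Lemma comparison_triangle (a b c : R) : 0 <= a -> 0 <= b -> 0 <= c ->
  a <= b + c -> b <= a + c -> c <= a + b ->
  exists w0 w1 w2 : R * R,
    [/\ plane_dist w0 w1 = a, plane_dist w1 w2 = c & plane_dist w2 w0 = b].
Proof.
move=> a0 b0 c0 abc bac cab; have [a_gt0|] := ltP 0 a; last first.
  move=> ale0; have {ale0}a_eq : a = 0 by apply/eqP; rewrite eq_le ale0 a0.
  subst a; have -> : c = b by lra.
  exists (0, 0), (0, 0), (b, 0).
  by split; apply: plane_distE => //=; ring.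
pose u := (a ^+ 2 + b ^+ 2 - c ^+ 2) / (2 * a).
have uE : 2 * a * u = a ^+ 2 + b ^+ 2 - c ^+ 2 by rewrite /u; field; lra.
have h0 : 0 <= b ^+ 2 - u ^+ 2.
  have -> : b ^+ 2 - u ^+ 2 =
      (4 * a ^+ 2 * b ^+ 2 - (2 * a * u) ^+ 2) / (4 * a ^+ 2) by field; lra.
  apply: divr_ge0; last nra.
  rewrite uE; have -> : 4 * a ^+ 2 * b ^+ 2 - (a ^+ 2 + b ^+ 2 - c ^+ 2) ^+ 2 =
    ((a + b - c) * (a + b + c)) * ((c - a + b) * (c + a - b)) by ring.
  by apply: mulr_ge0; apply: mulr_ge0; lra.
exists (0, 0), (a, 0), (u, Num.sqrt (b ^+ 2 - u ^+ 2)).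
split; apply: plane_distE => //=.
- by ring.
- by rewrite sub0r sqrrN sqr_sqrtr//; lra.
- by rewrite !subr0 sqr_sqrtr//; lra.
Qed.

End Plane.

(** * Stewart's inequality *)

Section Cat0.
Context {R : realType} {X : metricType R}.
Hypothesis X_CAT0 : CAT0 X.
Implicit Types (x p q : X) (c g : R -> X) (a b s t : R).

(** The comparison inequality between a vertex and a point of the opposite side.
In the plane both sides are equal, by Stewart's theorem. The curvature bound
enters all later arguments through this inequality. *)
Lemma stewart x p q g s : geodesic_between p q g -> 0 <= s <= 1 ->
  mdist x (g (s * mdist p q)) ^+ 2 <=
  (1 - s) * mdist x p ^+ 2 + s * mdist x q ^+ 2 - s * (1 - s) * mdist p q ^+ 2.
Proof.
move=> gpq /andP[s0 s1]; case: X_CAT0 => geoX cat.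
have [gxp hxp] := geoX x p; have [gqx hqx] := geoX q x.
pose v (i : 'I_3) := match val i with 0%N => x | 1%N => p | _ => q end.
pose cc (i : 'I_3) := match val i with 0%N => gxp | 1%N => g | _ => gqx end.
have [] := @comparison_triangle R (mdist x p) (mdist x q) (mdist p q).
- exact: mdist_ge0.
- exact: mdist_ge0.
- exact: mdist_ge0.
- by rewrite [mdist p q]metric_sym; exact: metric_triangle.
- exact: metric_triangle.
- by rewrite [mdist x p]metric_sym; exact: metric_triangle.
move=> w0 [w1 [w2 [w01 w12 w20]]].
pose w (i : 'I_3) := match val i with 0%N => w0 | 1%N => w1 | _ => w2 end.
(* The point of the comparison side that corresponds to the given point. *)
pose z := ((1 - s) * w1.1 + s * w2.1, (1 - s) * w1.2 + s * w2.2) : R * R.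
have d0 := mdist_ge0 p q.
have key : mdist (g (s * mdist p q)) (gxp 0) <= plane_dist z w0.
  apply: (cat v cc w _ _ (@Ordinal 3 1 isT) (@Ordinal 3 0 isT) (s * mdist p q) 0).
  - by case; case=> [|[|[|//]]] i.
  - case; case=> [|[|[|//]]] i; rewrite /w /v /=; [exact: w01|exact: w12|].
    by rewrite w20 metric_sym.
  - by rewrite /v in_itv/=; nra.
  - by rewrite /v in_itv/= lexx mdist_ge0.
  - rewrite /w /=; apply: plane_distE; first nra.
    by rewrite exprMn -w12 sqr_plane_dist /=; ring.
  - rewrite /w /v /=; apply: plane_distE; first by nra.
    rewrite (_ : _ - _ * _ = (1 - s) * mdist p q); last by rewrite /=; ring.
    by rewrite exprMn -w12 sqr_plane_dist /=; ring.
  - by rewrite /w /=; apply: plane_distE => //; ring.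
  - by rewrite /w /v /= subr0.
case: hxp => _ hx0 _; rewrite hx0 metric_sym in key.
rewrite -(@ler_pXn2r _ 2) ?nnegrE ?mdist_ge0 ?plane_dist_ge0// in key.
apply: le_trans key _.
rewrite -w01 -w12 -w20 !sqr_plane_dist /= le_eqVlt; apply/orP; left; apply/eqP.
by ring.
Qed.
End Cat0.

(** * Geodesics and rays as isometric curves *)

Section Geodesics.
Context {R : realType} {X : metricType R}.
Implicit Types (x p q : X) (c g : R -> X) (a b s t : R).

Lemma isometric_onS (I J : set R) c :
  J `<=` I -> isometric_on I c -> isometric_on J c.
Proof. by move=> JI ic s t /JI Is /JI It; exact: ic. Qed.

Lemma ray_isometric_on a c : rays c -> isometric_on `[0, a] c.
Proof. by apply: isometric_onS => s /=; rewrite !in_itv/= => /andP[->]. Qed.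

Lemma mdist_isometric_on a c s t : isometric_on `[0, a] c ->
  0 <= s <= a -> 0 <= t <= a -> mdist (c s) (c t) = `|s - t|.
Proof. by move=> ic sa ta; apply: ic; rewrite /= in_itv/=. Qed.

Lemma mdist_ray c s t : rays c -> 0 <= s -> 0 <= t ->
  mdist (c s) (c t) = `|s - t|.
Proof. by move=> rc s0 t0; apply: rc; rewrite /= in_itv/= andbT. Qed.

Lemma mdist_isometric_on0 a c t : isometric_on `[0, a] c ->
  0 <= t <= a -> mdist (c 0) (c t) = t.
Proof.
move=> ic /andP[t0 ta]; rewrite (mdist_isometric_on ic) ?sub0r ?normrN ?ger0_norm//.
- by rewrite lexx (le_trans t0).
- by rewrite t0.
Qed.

Lemma mdist_ray0 c t : rays c -> 0 <= t -> mdist (c 0) (c t) = t.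
Proof. by move=> rc t0; rewrite mdist_ray// sub0r normrN ger0_norm. Qed.

Lemma isometric_on_rev a c :
  isometric_on `[0, a] c -> isometric_on `[0, a] (fun t => c (a - t)).
Proof.
move=> ic s t /=; rewrite !in_itv/= => /andP[s0 sa] /andP[t0 ta].
rewrite (mdist_isometric_on ic); last 2 first.
- by rewrite subr_ge0 sa lerBlDr lerDl.
- by rewrite subr_ge0 ta lerBlDr lerDl.
by rewrite -normrN; congr (`| _ |); ring.
Qed.

Lemma isometric_on_geodesic a c : 0 <= a -> isometric_on `[0, a] c ->
  geodesic_between (c 0) (c a) c.
Proof.
move=> a0 ic; have e : mdist (c 0) (c a) = a.
  by rewrite (mdist_isometric_on0 ic)// a0 lexx.
by split; rewrite ?e.
Qed.

End Geodesics.

Arguments ray_isometric_on {R X} a {c}.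

(** * Convexity of the metric *)

Section Convexity.
Context {R : realType} {X : metricType R}.
Hypothesis X_CAT0 : CAT0 X.
Implicit Types (x p q : X) (c g : R -> X) (a b s t : R).

Lemma geodesic_stewart x a c t : isometric_on `[0, a] c -> 0 <= t <= a ->
  a * mdist x (c t) ^+ 2 <=
  (a - t) * mdist x (c 0) ^+ 2 + t * mdist x (c a) ^+ 2 - t * (a - t) * a.
Proof.
move=> ic /andP[t0 ta]; have a0 := le_trans t0 ta.
have e : mdist (c 0) (c a) = a by rewrite (mdist_isometric_on0 ic)// a0 lexx.
have [a_gt0|a_le0] := ltP 0 a; last first.
  have a_eq : a = 0 by lra.
  have -> : t = 0 by lra.
  by rewrite a_eq; lra.
have s01 : 0 <= t / a <= 1 by rewrite divr_ge0//= ler_pdivrMr// mul1r.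
have := stewart X_CAT0 x (isometric_on_geodesic a0 ic) s01.
rewrite e divfK ?gt_eqF// => /(ler_wpM2l a0) /le_trans; apply.
by rewrite le_eqVlt; apply/orP; left; apply/eqP; field; rewrite gt_eqF.
Qed.

(** Applying Stewart's inequality to both sides of an angle shows that the
Euclidean angle with sides a and b and opposite side e grows with a and b. *)
Lemma hinge a b c c' s t :
  isometric_on `[0, a] c -> isometric_on `[0, b] c' -> c 0 = c' 0 ->
  0 <= s <= a -> 0 <= t <= b ->
  a * b * mdist (c s) (c' t) ^+ 2 <=
  a * b * (s ^+ 2 + t ^+ 2) -
  s * t * (a ^+ 2 + b ^+ 2 - mdist (c a) (c' b) ^+ 2).
Proof.
move=> ic ic' c0 sa tb.
have h1 := geodesic_stewart (c' b) ic sa.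
have h2 := geodesic_stewart (c s) ic' tb.
have /andP[s0 sa'] := sa; have /andP[t0 tb'] := tb.
have a0 := le_trans s0 sa'; have b0 := le_trans t0 tb'.
rewrite c0 (metric_sym (c' b) (c' 0)) (mdist_isometric_on0 ic') ?b0 ?lexx// in h1.
rewrite (metric_sym (c s) (c' 0)) -c0 (mdist_isometric_on0 ic)// in h2.
rewrite (metric_sym (c' b) (c s)) (metric_sym (c' b) (c a)) in h1.
move: h1 h2 => /(ler_wpM2l t0) h1 /(ler_wpM2l a0) h2.
by lra.
Qed.

Lemma hinge_scaled a b c c' s :
  isometric_on `[0, a] c -> isometric_on `[0, b] c' -> c 0 = c' 0 ->
  0 <= a -> 0 <= b -> 0 <= s <= 1 ->
  mdist (c (s * a)) (c' (s * b)) <= s * mdist (c a) (c' b).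
Proof.
move=> ic ic' c0 a0 b0 /andP[s0 s1].
have [a_gt0|a_le0] := ltP 0 a; last first.
  have -> : a = 0 by lra.
  rewrite mulr0 c0 !(mdist_isometric_on0 ic') ?b0 ?lexx//.
  by rewrite mulr_ge0//= ler_piMl.
have [b_gt0|b_le0] := ltP 0 b; last first.
  have -> : b = 0 by lra.
  rewrite mulr0 -c0 ![mdist _ (c 0)]metric_sym !(mdist_isometric_on0 ic) ?a0 ?lexx//.
  by rewrite mulr_ge0//= ler_piMl.
rewrite -(@ler_pXn2r _ 2) ?nnegrE ?mdist_ge0 ?mulr_ge0 ?mdist_ge0//.
have ab : 0 < a * b by rewrite mulr_gt0.
rewrite -(ler_pM2l ab).
apply: le_trans (hinge ic ic' c0 _ _) _.
- by rewrite mulr_ge0//= ler_piMl.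
- by rewrite mulr_ge0//= ler_piMl.
by rewrite le_eqVlt; apply/orP; left; apply/eqP; ring.
Qed.

Lemma geodesic_exists p q : exists c,
  [/\ isometric_on `[0, mdist p q] c, c 0 = p & c (mdist p q) = q].
Proof. by case: X_CAT0 => /(_ p q)[c [? ? ?]]; exists c. Qed.

(** The diagonal splits the quadrilateral into two triangles. *)
Lemma mdist_convex a b c c' s :
  isometric_on `[0, a] c -> isometric_on `[0, b] c' ->
  0 <= a -> 0 <= b -> 0 <= s <= 1 ->
  mdist (c (s * a)) (c' (s * b)) <=
  (1 - s) * mdist (c 0) (c' 0) + s * mdist (c a) (c' b).
Proof.
move=> ic ic' a0 b0 s01; have /andP[s0 s1] := s01.
have [g [ig g0 g1]] := geodesic_exists (c 0) (c' b).
have m0 := mdist_ge0 (c 0) (c' b).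
have h1 := hinge_scaled ic ig (esym g0) a0 m0 s01.
have h2 := hinge_scaled (isometric_on_rev ig) (isometric_on_rev ic')
  (_ : _ = _) m0 b0 (_ : 0 <= 1 - s <= 1).
have := metric_triangle (c (s * a)) (g (s * mdist (c 0) (c' b))) (c' (s * b)).
rewrite g1 in h1.
move: h2; rewrite /= !subr0 !subrr g0 g1.
have e1 (r : R) : r - (1 - s) * r = s * r by ring.
rewrite !e1.
move=> /(_ erefl); rewrite subr_ge0 s1 lerBlDr lerDl s0 => /(_ isT).
by lra.
Qed.

(** Stewart's inequality at the midpoint of one diagonal, seen from the two ends
of the other diagonal. *)
Lemma quadrilateral (p q x y : X) :
  mdist p x ^+ 2 + mdist q y ^+ 2 <=
  mdist p q ^+ 2 + mdist q x ^+ 2 + mdist x y ^+ 2 + mdist y p ^+ 2.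
Proof.
have [g gpx] : exists g, geodesic_between p x g by case: X_CAT0.
have h : 0 <= (2^-1 : R) <= 1 by lra.
have hq := stewart X_CAT0 q gpx h; have hy := stewart X_CAT0 y gpx h.
move: hq hy; set m := g _ => hq hy.
have tri := metric_triangle q m y.
have : mdist q y ^+ 2 <= 2 * (mdist q m ^+ 2 + mdist y m ^+ 2).
  rewrite (metric_sym y m).
  have := mdist_ge0 q y; have := mdist_ge0 q m; have := mdist_ge0 m y.
  have := sqr_ge0 (mdist q m - mdist m y); nra.
rewrite (metric_sym p q) (metric_sym x y).
by lra.
Qed.

(** Geodesics with nearby ends stay close also at equal times, since their
lengths differ by at most the sum of the distances of the ends. *)
Lemma geodesic_fellow a b c c' A B t :
  isometric_on `[0, a] c -> isometric_on `[0, b] c' ->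
  mdist (c 0) (c' 0) <= A -> mdist (c a) (c' b) <= B ->
  0 <= t <= a -> t <= b -> mdist (c t) (c' t) <= 2 * (A + B).
Proof.
move=> ic ic' hA hB /andP[t0 ta] tb.
have A0 := le_trans (mdist_ge0 _ _) hA; have B0 := le_trans (mdist_ge0 _ _) hB.
have [a_gt0|a_le0] := ltP 0 a; last first.
  by have -> : t = 0; lra.
have a0 := ltW a_gt0; have b0 := le_trans t0 tb.
have s01 : 0 <= t / a <= 1 by rewrite divr_ge0//= ler_pdivrMr// mul1r.
have h := mdist_convex ic ic' a0 b0 s01; rewrite divfK ?gt_eqF// in h.
have sb : 0 <= t / a * b <= b.
  by case/andP: s01 => s0 s1; rewrite mulr_ge0//= ler_piMl.
have tri := metric_triangle (c t) (c' (t / a * b)) (c' t).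
rewrite (mdist_isometric_on ic' sb) in tri; last by rewrite t0.
have ab : `|b - a| <= A + B.
  have <- : mdist (c 0) (c a) = a by rewrite (mdist_isometric_on0 ic) ?a0 ?lexx.
  have <- : mdist (c' 0) (c' b) = b by rewrite (mdist_isometric_on0 ic') ?b0 ?lexx.
  have := metric_triangle (c 0) (c' 0) (c a).
  have := metric_triangle (c' 0) (c' b) (c a).
  have := metric_triangle (c' 0) (c 0) (c' b).
  have := metric_triangle (c 0) (c a) (c' b).
  rewrite (metric_sym (c' b) (c a)) (metric_sym (c' 0) (c 0)) ler_norml; lra.
have : `|t / a * b - t| <= A + B.
  have -> : t / a * b - t = t / a * (b - a) by field; lra.
  case/andP: s01 => s0 s1.
  by rewrite normrM (ger0_norm s0) (le_trans _ ab)// ler_piMl.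
have : (1 - t / a) * mdist (c 0) (c' 0) + t / a * mdist (c a) (c' b) <= A + B.
  by case/andP: s01 => s0 s1; have := mdist_ge0 (c 0) (c' 0);
     have := mdist_ge0 (c a) (c' b); nra.
by lra.
Qed.

End Convexity.

(** * Asymptotic rays *)

Section Rays.
Context {R : realType} {X : metricType R}.
Hypothesis X_CAT0 : CAT0 X.
Implicit Types (x p q : X) (c g : R -> X) (a b s t : R).

Lemma asymptotic_sym c c' : asymptotic c c' -> asymptotic c' c.
Proof. by move=> [M h]; exists M => t t0; rewrite metric_sym h. Qed.

Lemma asymptotic_trans c c' c'' :
  asymptotic c c' -> asymptotic c' c'' -> asymptotic c c''.
Proof.
move=> [M h] [N k]; exists (M + N) => t t0.
by apply: le_trans (metric_triangle _ (c' t) _) _; rewrite lerD ?h ?k.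
Qed.

(** The distance between two rays is convex, and bounded convex functions on
a half-line do not increase. *)
Lemma asymptotic_mdist_le c c' t : rays c -> rays c' -> asymptotic c c' ->
  0 <= t -> mdist (c t) (c' t) <= mdist (c 0) (c' 0).
Proof.
move=> rc rc' [M cc'] t0; apply/ler_addgt0Pl => e e0.
have M0 : 0 <= M by rewrite (le_trans _ (cc' 0 (lexx _)))// mdist_ge0.
(* Far enough for the bound M at T to contribute at most e at t. *)
pose T := t * (M + 1) / e + t + 1.
have tM : 0 <= t * (M + 1) / e by rewrite divr_ge0 ?(ltW e0)// mulr_ge0// addr_ge0.
have T0 : 0 < T by rewrite /T; lra.
have s01 : 0 <= t / T <= 1.
  by rewrite divr_ge0 ?(ltW T0)//= ler_pdivrMr// mul1r /T; lra.
have := mdist_convex X_CAT0 (ray_isometric_on T rc) (ray_isometric_on T rc')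
  (ltW T0) (ltW T0) s01.
rewrite divfK ?gt_eqF// => /le_trans; apply.
have : t / T * mdist (c T) (c' T) <= e.
  apply: (@le_trans _ _ (t / T * M)).
    by case/andP: s01 => s0 _; rewrite ler_wpM2l ?cc' ?(ltW T0).
  rewrite mulrAC ler_pdivrMr//.
  have -> : e * T = t * (M + 1) + e * t + e by rewrite /T; field; lra.
  by nra.
have := mdist_ge0 (c 0) (c' 0); case/andP: s01; nra.
Qed.

End Rays.

(** * Limits along an ultrafilter *)

Lemma ultra_fmap (S T : Type) (h : S -> T) (F : set_system S) :
  UltraFilter F -> UltraFilter (h @ F).
Proof.
move=> FU; split; first exact: fmap_proper_filter.
move=> G GF FG; rewrite predeqE => A; split; last exact: FG.
move=> GA; have [//|FnA] := in_ultra_setVsetC (h @^-1` A) FU.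
have GnA : G (~` A) by exact: FG.
by have /filter_ex [? []] : G (A `&` ~` A) by exact: filterI.
Qed.

Section UltraLimits.
Context {R : realType} {X : metricType R} (U : set_system nat).
Hypothesis U_ultra : UltraFilter U.
Implicit Types (x p q : X) (c : R -> X) (a b s t M : R) (u v : nat -> X).

Lemma ulim_mdist_lt u x (e : R) : u n @[n --> U] --> x -> 0 < e ->
  \forall n \near U, mdist x (u n) < e.
Proof. by move=> ux e0; have := ux _ (nbhsx_ballx x e e0); rewrite ballEmdist. Qed.

Lemma mdist_ulim_le u v x y M :
  u n @[n --> U] --> x -> v n @[n --> U] --> y ->
  (\forall n \near U, mdist (u n) (v n) <= M) -> mdist x y <= M.
Proof.
move=> ux vy uv; apply/ler_addgt0Pl => /= e e0.
have e2 : 0 < e / 2 by rewrite divr_gt0.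
have hu := ulim_mdist_lt ux e2.
have hv := ulim_mdist_lt vy e2.
have [n [/= h1 [h2 h3]]] := filter_ex (filterI hu (filterI hv uv)).
have := metric_triangle x (u n) y; have := metric_triangle (u n) (v n) y.
rewrite (metric_sym (v n) y); move: h1 h2 h3; lra.
Qed.

Lemma mdist_ulim_ge u v x y M :
  u n @[n --> U] --> x -> v n @[n --> U] --> y ->
  (\forall n \near U, M <= mdist (u n) (v n)) -> M <= mdist x y.
Proof.
move=> ux vy uv; apply/ler_addgt0Pl => /= e e0.
have e2 : 0 < e / 2 by rewrite divr_gt0.
have hu := ulim_mdist_lt ux e2.
have hv := ulim_mdist_lt vy e2.
have [n [/= h1 [h2 h3]]] := filter_ex (filterI hu (filterI hv uv)).
have := metric_triangle (u n) x (v n); have := metric_triangle x y (v n).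
rewrite (metric_sym (u n) x); move: h1 h2 h3; lra.
Qed.

Hypothesis X_proper : proper_space X.

Lemma ulim_exists u x M : (\forall n \near U, mdist x (u n) <= M) ->
  exists l : X, u n @[n --> U] --> l.
Proof.
move=> uM; pose B := [set y | mdist x y <= M].
have cB : compact B.
  apply: X_proper.
    move=> y By; apply/ler_addgt0Pl => /= e e0.
    have [z [xz]] := By _ (nbhsx_ballx y e e0).
    rewrite ballEmdist/= => yz.
    have := metric_triangle x z y; rewrite (metric_sym z y); move: yz.
    by have : mdist x z <= M := xz; lra.
  exists (M + M) => y z By Bz; apply: le_trans (metric_triangle _ x _) _.
  by rewrite (metric_sym y) lerD.
rewrite compact_ultra in cB.
have UF := @ultra_fmap _ _ u _ U_ultra.
by have [l [_ ul]] := cB _ UF uM; exists l.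
Qed.

(** Balls are compact, so the points at distance t from x on geodesics from x
converge along the ultrafilter for every t at once; no diagonal subsequence has
to be chosen. *)
Lemma ulim_ray (g : nat -> R -> X) (L : nat -> R) x :
  (forall n, isometric_on `[0, L n] (g n)) -> (forall n, g n 0 = x) ->
  (forall M, \forall n \near U, M <= L n) ->
  exists c, [/\ rays c, c 0 = x &
    forall t, 0 <= t -> g n t @[n --> U] --> c t].
Proof.
move=> ig g0 Loo.
have ex t : exists l : X, 0 <= t -> g n t @[n --> U] --> l.
  have [t0|t0] := leP 0 t; last by exists x.
  have [|l gl] := @ulim_exists (fun n => g n t) x t; last by exists l.
  apply: filterS (Loo t) => n tL.
  by rewrite -(g0 n) (mdist_isometric_on0 (ig n)) ?t0.
have [c cP] := choice ex; exists c; split => //.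
- move=> s t /=; rewrite !in_itv/= !andbT => s0 t0.
  have h : \forall n \near U, mdist (g n s) (g n t) = `|s - t|.
    apply: filterS2 (Loo s) (Loo t) => n sL tL.
    by rewrite (mdist_isometric_on (ig n)) ?s0 ?t0.
  apply/eqP; rewrite eq_le; apply/andP; split.
    apply: mdist_ulim_le (cP _ s0) (cP _ t0) _.
    by apply: filterS h => n ->.
  apply: mdist_ulim_ge (cP _ s0) (cP _ t0) _.
  by apply: filterS h => n ->.
- apply/esym/mdist_positivity/eqP; rewrite eq_le mdist_ge0 andbT.
  apply: mdist_ulim_le (cvg_cst x) (cP 0 (lexx _)) _.
  by apply: nearW => n; rewrite g0 mdistxx.
Qed.

End UltraLimits.

Lemma ultrafilter_at_infinity :
  exists U : set_system nat, UltraFilter U /\ \oo `<=` U.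
Proof.
by have [U [UU h]] := @ultraFilterLemma nat (\oo : set_system nat) _; exists U.
Qed.

(** * The ideal boundary *)

Section Boundary.
Context {R : realType} {X : metricType R}.
Hypotheses (X_CAT0 : CAT0 X) (X_proper : proper_space X).
Implicit Types (p q : X) (c g : R -> X) (a b s t M : R) (x y : ideal_boundary X).

(** Limit of the segments from p to the points of the given ray. *)
Lemma asymptotic_ray_exists p c : rays c ->
  exists c', [/\ rays c', c' 0 = p & asymptotic c c'].
Proof.
move=> rc; have [U [U_ultra Uoo]] := ultrafilter_at_infinity.
have [g gP] := choice (fun n : nat => geodesic_exists X_CAT0 p (c n%:R)).
have Lge (n : nat) : n%:R - mdist p (c 0) <= mdist p (c n%:R).
  have := metric_triangle (c 0) p (c n%:R).
  by rewrite mdist_ray0// (metric_sym (c 0)); lra.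
have Loo M : \forall n \near U, M <= mdist p (c n%:R).
  have /Uoo := nbhs_infty_ger (M + mdist p (c 0)).
  by apply: filterS => n /= h; apply: le_trans (Lge n); lra.
have [|||c' [rc' c'0 c'P]] := @ulim_ray _ _ _ U_ultra X_proper g
  (fun n => mdist p (c n%:R)) p.
- by move=> n; case: (gP n).
- by move=> n; case: (gP n).
- exact: Loo.
exists c'; split => //; exists (2 * (mdist p (c 0))) => t t0.
rewrite metric_sym.
apply: mdist_ulim_le (c'P t t0) (cvg_cst (c t)) _ => //.
have Un : \forall n \near U, t <= n%:R := Uoo _ (nbhs_infty_ger t).
apply: filterS2 (Loo t) Un => n tL tn.
have [ig g0 g1] := gP n.
rewrite -[mdist p (c 0)]addr0.
apply: (geodesic_fellow X_CAT0 ig (ray_isometric_on n%:R rc)) => //.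
- by rewrite g0.
- by rewrite g1 mdistxx.
- by rewrite t0.
Qed.

Lemma boundary_rays x c : val x c -> rays c.
Proof. by have [c' _ <-] := set_valP x; case. Qed.

Lemma boundary_asymptotic x c c' : val x c -> val x c' -> asymptotic c c'.
Proof.
have [c0 _ <-] := set_valP x => -[_ h] [_ h'].
exact: asymptotic_trans (asymptotic_sym h) h'.
Qed.

Lemma boundary_closed x c c' : val x c -> rays c' -> asymptotic c c' -> val x c'.
Proof.
have [c0 _ <-] := set_valP x => -[rc h] rc' h'; split=> //.
exact: asymptotic_trans h h'.
Qed.

Lemma boundary_of_ray c : rays c -> exists x, val x c.
Proof.
move=> rc; have h : [set class_in (@rays R X) (@asymptotic R X) c | c in @rays R X]
    (class_in (@rays R X) (@asymptotic R X) c) by exists c.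
exists (SigSub (mem_set h) : ideal_boundary X) => /=; split => //.
by exists 0 => t t0; rewrite mdistxx.
Qed.

Lemma boundary_eq x y c : val x c -> val y c -> x = y.
Proof.
move=> xc yc; apply: val_inj; apply/seteqP; split => c' h.
  apply: boundary_closed yc (boundary_rays h) _.
  exact: boundary_asymptotic xc h.
apply: boundary_closed xc (boundary_rays h) _.
exact: boundary_asymptotic yc h.
Qed.

Lemma ray_toP p x : val x (ray_to p x) /\ ray_to p x 0 = p.
Proof.
rewrite /ray_to; case: xgetP => [c _ //|nex].
have [c rc xE] := set_valP x.
have xc : val x c.
  by rewrite -xE; split=> //; exists 0 => t t0; rewrite mdistxx.
have [c' [rc' c'0 cc']] := asymptotic_ray_exists p rc.
by exfalso; apply: (nex c'); split=> //; exact: boundary_closed xc rc' cc'.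
Qed.

Lemma ray_to_val p x : val x (ray_to p x).
Proof. by case: (ray_toP p x). Qed.

Lemma ray_to0 p x : ray_to p x 0 = p.
Proof. by case: (ray_toP p x). Qed.

Lemma ray_to_ray p x : rays (ray_to p x).
Proof. exact: boundary_rays (ray_to_val p x). Qed.

Lemma boundary_mdist_le x c c' t : val x c -> val x c' -> 0 <= t ->
  mdist (c t) (c' t) <= mdist (c 0) (c' 0).
Proof.
move=> xc xc'; apply: asymptotic_mdist_le => //.
- exact: boundary_rays xc.
- exact: boundary_rays xc'.
- exact: boundary_asymptotic xc xc'.
Qed.

End Boundary.

(** * Comparison angles and Alexandrov angles *)

Section ComparisonAngles.
Context {R : realType} {X : metricType R}.
Implicit Types (p q : X) (c : R -> X) (a b s t : R).

Lemma acos_le (u v : R) : -1 <= u <= 1 -> -1 <= v <= 1 -> u <= v ->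
  acos v <= acos u.
Proof.
move=> hu hv uv; rewrite leNgt; apply/negP => h.
have := @ltr_cos R (acos u) (acos v).
rewrite !in_itv/= !acos_ge0// !acos_lepi// !acosK ?in_itv//= => /(_ isT isT).
by rewrite h ltNge uv.
Qed.

Lemma acos_le_of_cos (u v : R) : -1 <= u <= 1 -> 0 <= v <= pi -> cos v <= u ->
  acos u <= v.
Proof.
move=> hu hv uv; rewrite -[leRHS]cosK ?in_itv//.
by apply: acos_le; rewrite // cos_geN1 cos_le1.
Qed.

Lemma cos_ratio_itv (a b c : R) : 0 <= a -> 0 <= b -> 0 <= c ->
  a <= b + c -> b <= a + c -> c <= a + b ->
  -1 <= (a ^+ 2 + b ^+ 2 - c ^+ 2) / (2 * a * b) <= 1.
Proof.
move=> a0 b0 c0 abc bac cab; have [ab0|ab0] := ltP 0 (2 * a * b); last first.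
  have -> : 2 * a * b = 0.
    by apply/eqP; rewrite eq_le ab0 !mulr_ge0.
  by rewrite invr0 mulr0 lerN10 ler01.
rewrite ler_pdivlMr// ler_pdivrMr// mulN1r mul1r.
have h1 : 0 <= (a + b - c) * (a + b + c) by rewrite mulr_ge0; lra.
have h2 : 0 <= (c - a + b) * (c + a - b) by rewrite mulr_ge0; lra.
by apply/andP; split; nra.
Qed.

Lemma mdist_cos_ratio_itv p x y :
  -1 <= (mdist p x ^+ 2 + mdist p y ^+ 2 - mdist x y ^+ 2) /
        (2 * mdist p x * mdist p y) <= 1.
Proof.
apply: cos_ratio_itv; rewrite ?mdist_ge0//.
- by rewrite (metric_sym x); exact: metric_triangle.
- exact: metric_triangle.
- by rewrite (metric_sym p x); exact: metric_triangle.
Qed.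

Lemma comparison_angle_ge0 p x y : 0 <= comparison_angle p x y.
Proof. exact/acos_ge0/mdist_cos_ratio_itv. Qed.

Lemma comparison_angle_lepi p x y : comparison_angle p x y <= pi.
Proof. exact/acos_lepi/mdist_cos_ratio_itv. Qed.

(** The upper limit before it is turned into a real number. That it is finite
has to be known before a bound on it says anything about the angle. *)
Definition angle_limsup p c c' : \bar R :=
  limf_esup (fun st : R * R => (comparison_angle p (c st.1) (c' st.2))%:E)
            (filter_prod (0 : R)^'+ (0 : R)^'+).

Lemma angle_limsup_le p c c' (B : R) :
  (forall s t, 0 < s -> 0 < t -> comparison_angle p (c s) (c' t) <= B) ->
  (angle_limsup p c c' <= B%:E)%E.
Proof.
move=> h; apply: ge_ereal_inf.
exists (ereal_sup [set (comparison_angle p (c st.1) (c' st.2))%:E |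
    st in [set st : R * R | 0 < st.1 /\ 0 < st.2]]).
  exists [set st : R * R | 0 < st.1 /\ 0 < st.2] => //.
  exists ([set s | 0 < s], [set s | 0 < s]) => //=.
  by split; exact: nbhs_right_gt.
by apply: ge_ereal_sup => _ [[s t] [/= s0 t0] <-]; rewrite lee_fin h.
Qed.

Lemma angle_limsup_fin p c c' : angle_limsup p c c' = (angle p c c')%:E.
Proof.
rewrite /angle -/(angle_limsup p c c') fineK// ge0_fin_numE.
  apply: (@le_lt_trans _ _ (pi : R)%:E); last by rewrite ltry.
  by apply: angle_limsup_le => s t _ _; exact: comparison_angle_lepi.
apply: limf_esup_ge0 => [|st]; last by rewrite lee_fin comparison_angle_ge0.
exact: filter_not_empty.
Qed.

Lemma angle_le p c c' (B : R) :
  (forall s t, 0 < s -> 0 < t -> comparison_angle p (c s) (c' t) <= B) ->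
  angle p c c' <= B.
Proof. by move=> /angle_limsup_le; rewrite angle_limsup_fin lee_fin. Qed.

Lemma angle_lepi p c c' : angle p c c' <= pi.
Proof. by apply: angle_le => s t _ _; exact: comparison_angle_lepi. Qed.

Lemma angle_lt_witness p c c' (B e : R) : angle p c c' < B -> 0 < e ->
  exists u, 0 < u < e /\ comparison_angle p (c u) (c' u) < B.
Proof.
rewrite -lte_fin -angle_limsup_fin => /ereal_inf_lt[_ [A FA <-]] AB e0.
have [[A1 A2] [/= h1 h2] A12] := FA.
have h3 : (0 : R)^'+ (A1 `&` A2 `&` ([set u | 0 < u] `&` [set u | u < e])).
  apply: filterI; apply: filterI => //.
    exact: nbhs_right_gt.
  exact: nbhs_right_lt.
have [u [[A1u A2u] [u0 ue]]] := filter_ex h3.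
exists u; split; first by rewrite u0 ue.
rewrite -lte_fin; apply: le_lt_trans AB; apply: ereal_sup_ubound.
by exists (u, u) => //; exact: A12.
Qed.

Lemma ideal_angle_ge p (x y : ideal_boundary X) :
  angle p (ray_to p x) (ray_to p y) <= ideal_angle x y.
Proof.
apply: ub_le_sup; last by exists p.
by exists pi => _ [q _ <-]; exact: angle_lepi.
Qed.

Lemma ideal_angle_le p0 (x y : ideal_boundary X) (B : R) :
  (forall p, angle p (ray_to p x) (ray_to p y) <= B) -> ideal_angle x y <= B.
Proof.
move=> h; apply: ge_sup; first by exists (angle p0 (ray_to p0 x) (ray_to p0 y)), p0.
by move=> _ [p _ <-].
Qed.

End ComparisonAngles.

(** * Chords at infinity *)

Section Chords.
Context {R : realType} {X : metricType R}.
Hypotheses (X_CAT0 : CAT0 X) (X_proper : proper_space X).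
Implicit Types (p q : X) (c g : R -> X) (a b s t M : R).
Implicit Types (x y z : ideal_boundary X).

(** Two points of the boundary at angle a are seen, at distance t along rays
from any base point, at a distance at most t times 2 sin (a / 2), the chord of a
in the unit circle. Chords are easier to handle than angles: they satisfy
the triangle inequality by definition and pass to limits of rays. *)
Definition chord_le x y (r : R) : Prop :=
  forall c c', val x c -> val y c' -> c 0 = c' 0 ->
  forall t, 0 <= t -> mdist (c t) (c' t) <= r * t.

Lemma chord_le_sym x y r : chord_le x y r -> chord_le y x r.
Proof. by move=> h c c' yc xc' c0 t t0; rewrite metric_sym; exact: h. Qed.

Lemma chord_leW x y r r' : r <= r' -> chord_le x y r -> chord_le x y r'.
Proof.
by move=> rr' h c c' xc yc' c0 t t0; apply: le_trans (h _ _ xc yc' c0 t t0) _;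
   exact: ler_wpM2r.
Qed.

Lemma chord_le_refl x : chord_le x x 0.
Proof.
move=> c c' xc xc' c0 t t0; rewrite mul0r.
by apply: le_trans (boundary_mdist_le X_CAT0 xc xc' t0) _; rewrite c0 mdistxx.
Qed.

Lemma chord_le_trans y x z r r' :
  chord_le x y r -> chord_le y z r' -> chord_le x z (r + r').
Proof.
move=> h h' c c' xc zc' c0 t t0.
have yk := ray_to_val X_CAT0 X_proper (c 0) y.
have k0 := ray_to0 X_CAT0 X_proper (c 0) y.
have h1 := h _ _ xc yk (esym k0) t t0.
have h2 := h' _ _ yk zc' (etrans k0 c0) t t0.
apply: le_trans (metric_triangle _ (ray_to (c 0) y t) _) _.
by rewrite mulrDl lerD.
Qed.

(** By convexity a bound up to an additive constant, from whatever base
points, is a bound without it from every common base point. *)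
Lemma chord_le_of_bounded x y r M c c' : val x c -> val y c' ->
  (forall t, 0 <= t -> mdist (c t) (c' t) <= r * t + M) -> chord_le x y r.
Proof.
move=> xc yc' h k k' xk yk' k0 t t0; apply/ler_addgt0Pl => /= e e0.
pose M' : R := `|M| + mdist (k 0) (c 0) + mdist (k' 0) (c' 0).
have M'0 : 0 <= M' by rewrite !addr_ge0 ?mdist_ge0.
(* The homothety that makes the additive error smaller than e. *)
pose N : R := M' / e + 1.
have N1 : 1 <= N by rewrite /N; have := divr_ge0 M'0 (ltW e0); lra.
have N0 : 0 < N by lra.
have Nt0 : 0 <= N * t by rewrite mulr_ge0// ltW.
have hN : mdist (k (N * t)) (k' (N * t)) <= r * (N * t) + M'.
  have h1 := boundary_mdist_le X_CAT0 xk xc Nt0.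
  have h2 := boundary_mdist_le X_CAT0 yk' yc' Nt0.
  have h3 := h _ Nt0.
  have h4 := metric_triangle (k (N * t)) (c (N * t)) (k' (N * t)).
  have h5 := metric_triangle (c (N * t)) (c' (N * t)) (k' (N * t)).
  have h6 := ler_norm M.
  rewrite (metric_sym (c' _)) in h5.
  by rewrite /M'; lra.
have s01 : 0 <= N^-1 <= 1 by rewrite invr_ge0 ltW//= invf_le1.
have := hinge_scaled X_CAT0 (ray_isometric_on (N * t) (boundary_rays xk))
  (ray_isometric_on (N * t) (boundary_rays yk')) k0 Nt0 Nt0 s01.
rewrite mulKf ?gt_eqF// => hs; apply: le_trans hs _.
rewrite ler_pdivrMl// (le_trans hN)//.
have -> : N * (e + r * t) = r * (N * t) + M' + e.
  by rewrite /N; field; rewrite gt_eqF.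
by lra.
Qed.

(** The bound at equal times T controls the comparison angle at T, and that
angle only decreases towards the base point. *)
Lemma chord_le_sqr x y r c c' s t : chord_le x y r ->
  val x c -> val y c' -> c 0 = c' 0 -> 0 <= s -> 0 <= t ->
  mdist (c s) (c' t) ^+ 2 <= s ^+ 2 + t ^+ 2 - s * t * (2 - r ^+ 2).
Proof.
move=> h xc yc' c0 s0 t0; pose T := s + t + 1.
have T0 : 0 < T by rewrite /T; lra.
have D := h _ _ xc yc' c0 T (ltW T0).
have D0 := mdist_ge0 (c T) (c' T).
have := @hinge _ _ X_CAT0 T T c c' s t (ray_isometric_on T (boundary_rays xc))
  (ray_isometric_on T (boundary_rays yc')) c0.
rewrite s0 t0 /= => /(_ _ _)/le_trans => hh.
rewrite -(ler_pM2l (mulr_gt0 T0 T0)).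
apply: hh; [by rewrite /T; lra|by rewrite /T; lra|].
have DT : mdist (c T) (c' T) ^+ 2 <= (r * T) ^+ 2.
  by rewrite ler_pXn2r ?nnegrE// (le_trans D0).
have st0 : 0 <= s * t by rewrite mulr_ge0.
have := ler_wpM2l st0 DT.
by lra.
Qed.

Lemma chord_cos_itv (r : R) : 0 <= r <= 2 -> -1 <= 1 - r ^+ 2 / 2 <= 1.
Proof. by move=> /andP[r0 r2]; apply/andP; split; nra. Qed.

Lemma chord_le_ideal_angle p0 x y r : 0 <= r <= 2 -> chord_le x y r ->
  ideal_angle x y <= acos (1 - r ^+ 2 / 2).
Proof.
move=> r02 h; apply: (ideal_angle_le p0) => p; apply: angle_le => s t s0 t0.
apply: acos_le; [exact: chord_cos_itv|exact: mdist_cos_ratio_itv|].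
have xk := ray_to_val X_CAT0 X_proper p x.
have yk := ray_to_val X_CAT0 X_proper p y.
have e : ray_to p x 0 = ray_to p y 0.
  by rewrite !(ray_to0 X_CAT0 X_proper).
have := chord_le_sqr h xk yk e (ltW s0) (ltW t0).
have d1 := mdist_ray0 (boundary_rays xk) (ltW s0).
have d2 := mdist_ray0 (boundary_rays yk) (ltW t0).
rewrite (ray_to0 X_CAT0 X_proper) in d1.
rewrite (ray_to0 X_CAT0 X_proper) in d2.
rewrite d1 d2 => hh.
rewrite ler_pdivlMr; first by lra.
by rewrite !mulr_gt0.
Qed.

Lemma boundary_shift x c t : val x c -> 0 <= t -> val x (fun u => c (t + u)).
Proof.
move=> xc t0; have rc := boundary_rays xc.
apply: (boundary_closed xc).
  move=> u v; rewrite /= !in_itv/= !andbT => u0 v0.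
  by rewrite mdist_ray ?addr_ge0//; congr (`| _ |); ring.
exists t => u u0; rewrite mdist_ray ?addr_ge0//.
by rewrite (_ : u - (t + u) = - t) ?normrN ?ger0_norm//; ring.
Qed.

Lemma ray_to_shift x c t u : val x c -> 0 <= t -> 0 <= u ->
  ray_to (c t) x u = c (t + u).
Proof.
move=> xc t0 u0; apply: mdist_positivity; apply/eqP.
rewrite eq_le mdist_ge0 andbT.
have xk := ray_to_val X_CAT0 X_proper (c t) x.
apply: le_trans (boundary_mdist_le X_CAT0 xk (boundary_shift xc t0) u0) _.
by rewrite (ray_to0 X_CAT0 X_proper) addr0 mdistxx.
Qed.

(** If the rays from c t to x and to y make a small angle, then the angle at
c t between c 0 and y is almost pi, so the distance from c 0 grows along
the ray from c t to y at almost full speed; the quadrilateral inequality turns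
this into an upper bound of the distance between the rays from c 0. *)
Lemma small_ideal_angle_chord (r : R) : 0 < r ->
  exists2 e : R, 0 < e & forall x y, ideal_angle x y < e -> chord_le x y r.
Proof.
move=> r0; (* An isosceles triangle with sides u and base b u has the angle
   acos (1 - b^2 / 2); the estimates below lead to a chord 2 sqrt b. *)
pose b : R := Num.min (r ^+ 2 / 4) 1.
have b0 : 0 < b by rewrite lt_min ltr01 divr_gt0 ?exprn_gt0.
have b1 : b <= 1 by rewrite ge_min lexx orbT.
have br : 4 * b <= r ^+ 2.
  have : b <= r ^+ 2 / 4 by rewrite ge_min lexx.
  lra.
have kitv : -1 <= 1 - b ^+ 2 / 2 < 1 by apply/andP; split; nra.
exists (acos (1 - b ^+ 2 / 2)); first exact: acos_gt0.
move=> x y xy c c' xc yc' c0 t; rewrite le_eqVlt => /orP[/eqP <-|t0].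
  by rewrite c0 mdistxx mulr0.
have t0' := ltW t0.
have yk := ray_to_val X_CAT0 X_proper (c t) y.
have rc := boundary_rays xc; have rk := boundary_rays yk.
have k0 := ray_to0 X_CAT0 X_proper (c t) y.
have := @angle_lt_witness _ _ (c t) (ray_to (c t) x) (ray_to (c t) y) _ t
  (le_lt_trans (ideal_angle_ge _ _ _) xy) t0.
move: yk rk k0; set k := ray_to (c t) y => yk rk k0 [u [/andP[u0 ut]]].
rewrite (ray_to_shift xc t0' (ltW u0)) /comparison_angle.
have kitv' : -1 <= 1 - b ^+ 2 / 2 <= 1 by case/andP: kitv => -> /ltW.
move: (mdist_cos_ratio_itv (c t) (c (t + u)) (k u)).
have -> : mdist (c t) (k u) = u by rewrite -k0 mdist_ray0// ltW.
have -> : mdist (c t) (c (t + u)) = u.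
  rewrite mdist_ray//; last by rewrite addr_ge0// ltW.
  by rewrite (_ : t - (t + u) = - u) ?normrN ?gtr0_norm//; ring.
move=> qitv; rewrite lt_leAnge => /andP[_ hacos].
set v := mdist _ _ in qitv hacos.
have {hacos} : 1 - b ^+ 2 / 2 <= (u ^+ 2 + u ^+ 2 - v ^+ 2) / (2 * u * u).
  rewrite leNgt; apply/negP => hlt; move: hacos => /negP; apply.
  by apply: acos_le; rewrite // ltW.
rewrite ler_pdivlMr ?mulr_gt0// => hv.
have v0 : 0 <= v := mdist_ge0 _ _.
have {hv} vbu : v <= b * u.
  rewrite -(@ler_pXn2r _ 2) ?nnegrE ?mulr_ge0 ?(ltW b0) ?(ltW u0)//.
  by lra.
(* The points c (t - u) and k u are almost opposite as seen from c t. *)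
pose w := mdist (c (t - u)) (k u).
have tu : 0 <= t - u by lra.
have wu : (2 - b) * u <= w.
  have := metric_triangle (c (t - u)) (k u) (c (t + u)).
  rewrite -/w (metric_sym (k u)) -/v mdist_ray//; last by lra.
  have -> : `|t - u - (t + u)| = 2 * u.
    by rewrite (_ : t - u - (t + u) = - (2 * u)) ?normrN ?gtr0_norm ?mulr_gt0//; ring.
  by lra.
have w2 : (4 - 4 * b) * u ^+ 2 <= w ^+ 2.
  have : ((2 - b) * u) ^+ 2 <= w ^+ 2.
    by rewrite ler_pXn2r ?nnegrE ?mdist_ge0 ?mulr_ge0 ?(ltW u0)//; lra.
  have : 0 <= b ^+ 2 * u ^+ 2 by rewrite mulr_ge0 ?sqr_ge0.
  by lra.
have hD := hinge X_CAT0 (isometric_on_rev (ray_isometric_on t rc))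
  (ray_isometric_on t rk) (_ : c (t - 0) = k 0)
  (_ : 0 <= u <= t) (_ : 0 <= u <= t).
move: hD; rewrite subr0 k0 subrr (ltW u0) (ltW ut) => /(_ erefl isT isT).
rewrite -/w; set D := mdist (c 0) (k t) => hD.
have {hD} hD : (4 - 4 * b) * t ^+ 2 <= D ^+ 2.
  have uu : 0 < u ^+ 2 by rewrite exprn_gt0.
  rewrite -(ler_pM2l uu).
  have := ler_wpM2l (sqr_ge0 t) w2.
  by lra.
have Q := quadrilateral X_CAT0 (c t) (c 0) (c' t) (k t).
have e1 : mdist (c t) (c 0) = t by rewrite metric_sym mdist_ray0.
have e2 : mdist (c 0) (c' t) = t by rewrite c0 mdist_ray0//; exact: boundary_rays yc'.
have e3 : mdist (k t) (c t) = t by rewrite metric_sym -k0 mdist_ray0.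
have e4 : mdist (c' t) (k t) <= t.
  apply: le_trans (boundary_mdist_le X_CAT0 yc' yk t0') _.
  by rewrite k0 -c0 mdist_ray0.
have {}e4 : mdist (c' t) (k t) ^+ 2 <= t ^+ 2.
  by rewrite ler_pXn2r ?nnegrE ?mdist_ge0.
rewrite e1 e2 e3 -/D in Q.
rewrite -(@ler_pXn2r _ 2) ?nnegrE ?mdist_ge0 ?mulr_ge0 ?(ltW r0)//.
have := ler_wpM2r (sqr_ge0 t) br.
by lra.
Qed.

(** The comparison angle at p grows along the segments, so a bound at their far
ends survives in the limit. *)
Lemma chord_le_ulim (U : set_system nat) (g g' : nat -> R -> X)
    (L L' : nat -> R) p x y c c' r :
  UltraFilter U -> 0 <= r ->
  (forall n, isometric_on `[0, L n] (g n)) -> (forall n, g n 0 = p) ->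
  (forall n, isometric_on `[0, L' n] (g' n)) -> (forall n, g' n 0 = p) ->
  (forall M, \forall n \near U, M <= L n) ->
  (forall M, \forall n \near U, M <= L' n) ->
  val x c -> (forall t, 0 <= t -> g n t @[n --> U] --> c t) ->
  val y c' -> (forall t, 0 <= t -> g' n t @[n --> U] --> c' t) ->
  (\forall n \near U, mdist (g n (L n)) (g' n (L' n)) ^+ 2 <=
     L n ^+ 2 + L' n ^+ 2 - L n * L' n * (2 - r ^+ 2)) ->
  chord_le x y r.
Proof.
move=> UU r0 ig g0 ig' g'0 Loo Loo' xc gc yc' gc' h.
apply: (@chord_le_of_bounded x y r 0 c c' xc yc') => t t0; rewrite addr0.
apply: (mdist_ulim_le UU (gc _ t0) (gc' _ t0)).
apply: filterS3 (Loo (t + 1)) (Loo' (t + 1)) h => n tL tL' hn.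
have H := hinge X_CAT0 (ig n) (ig' n) (etrans (g0 n) (esym (g'0 n)))
  (_ : 0 <= t <= L n) (_ : 0 <= t <= L' n).
have {H} := H (ltac:(by apply/andP; split; lra)) (ltac:(by apply/andP; split; lra)).
have LL : 0 < L n * L' n by rewrite mulr_gt0//; lra.
move=> H; rewrite -(@ler_pXn2r _ 2) ?nnegrE ?mdist_ge0 ?mulr_ge0//.
rewrite -(ler_pM2l LL); apply: le_trans H _.
have := ler_wpM2l (sqr_ge0 t) hn.
by lra.
Qed.

End Chords.

(** * Adding angles in the plane *)

Section PlanarAngles.
Context {R : realType}.
Implicit Types a b m u v : R.

Definition planar_angle a b u : R := acos ((a ^+ 2 + b ^+ 2 - u ^+ 2) / (2 * a * b)).

Lemma cauchy_schwarz_plane (p1 p2 q1 q2 u v : R) : 0 <= u -> 0 <= v ->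
  p1 ^+ 2 + p2 ^+ 2 = u ^+ 2 -> q1 ^+ 2 + q2 ^+ 2 = v ^+ 2 ->
  - (u * v) <= p1 * q1 + p2 * q2.
Proof.
move=> u0 v0 pu qv; suff : `|p1 * q1 + p2 * q2| <= u * v.
  by rewrite ler_norml => /andP[].
rewrite -(@ler_pXn2r _ 2) ?nnegrE ?mulr_ge0 ?normr_ge0// real_normK ?num_real//.
rewrite exprMn -pu -qv; have := sqr_ge0 (p1 * q2 - p2 * q1); lra.
Qed.

(** Place two triangles with sides a, m, u and b, m, v on the two sides of
a common side m. Then the ends of a and b are at distance at most u + v. *)
Lemma planar_angle_superadditive a b m u v : 0 < a -> 0 < b -> 0 < m ->
  0 <= u -> 0 <= v -> a <= m + u -> m <= a + u -> u <= a + m ->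
  b <= m + v -> m <= b + v -> v <= b + m ->
  a <= b + (u + v) -> b <= a + (u + v) -> u + v <= a + b ->
  planar_angle a m u + planar_angle m b v <= planar_angle a b (u + v).
Proof.
move=> a0 b0 m0 u0 v0 amu mau uam bmv mbv vbm abuv bauv uvab.
have ale := ltW a0; have ble := ltW b0; have mle := ltW m0.
have := @cos_ratio_itv R a m u ale mle u0.
have := @cos_ratio_itv R m b v mle ble v0.
have := @cos_ratio_itv R a b (u + v) ale ble (addr_ge0 u0 v0).
rewrite /planar_angle.
set q := (_ / _); set q2 := (_ / _); set q1 := (_ / _).
move=> /(_ (ltac:(lra)) (ltac:(lra)) (ltac:(lra))) hq.
move=> /(_ (ltac:(lra)) (ltac:(lra)) (ltac:(lra))) hq2.
move=> /(_ (ltac:(lra)) (ltac:(lra)) (ltac:(lra))) hq1.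
have q1E : q1 * (2 * a * m) = a ^+ 2 + m ^+ 2 - u ^+ 2.
  by rewrite /q1; field; rewrite !gt_eqF.
have q2E : q2 * (2 * m * b) = m ^+ 2 + b ^+ 2 - v ^+ 2.
  by rewrite /q2; field; rewrite !gt_eqF.
have qE : q * (2 * a * b) = a ^+ 2 + b ^+ 2 - (u + v) ^+ 2.
  by rewrite /q; field; rewrite !gt_eqF.
(* The angles add up to at most pi, so their sum can be compared with another
   angle through cosines. *)
have sum_ge0 : - q2 <= q1.
  have abm : 0 < 2 * a * b * m by rewrite !mulr_gt0.
  rewrite -(ler_pM2l abm).
  have h1 : 0 <= b * ((m - u + a) * (m + u - a)).
    by rewrite mulr_ge0// mulr_ge0; lra.
  have h2 : 0 <= a * ((m - v + b) * (m + v - b)).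
    by rewrite mulr_ge0// mulr_ge0; lra.
  have h3 : 0 <= a * b * (a + b - (u + v)).
    by rewrite mulr_ge0 ?mulr_ge0//; lra.
  have := congr1 (fun z => b * z) q1E; have := congr1 (fun z => a * z) q2E.
  by rewrite /=; lra.
have hs : acos q1 + acos q2 <= pi.
  suff : acos q1 <= acos (- q2) by rewrite acosN//; lra.
  by apply: acos_le; rewrite // lerN2 lerNl andbC.
have s0 : 0 <= acos q1 + acos q2 by rewrite addr_ge0 ?acos_ge0.
rewrite -[leLHS]cosK; last by rewrite in_itv/= s0.
apply: acos_le; rewrite ?cos_geN1 ?cos_le1// cosD !acosK ?in_itv//.
have ss1 := cos2Dsin2 (acos q1); have ss2 := cos2Dsin2 (acos q2).
rewrite acosK ?in_itv// in ss1; rewrite acosK ?in_itv// in ss2.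
set s1 := sin _ in ss1 *; set s2 := sin _ in ss2 *.
(* The vectors from the end of m to the ends of a and b. *)
have := @cauchy_schwarz_plane (a * q1 - m) (a * s1) (b * q2 - m) (- (b * s2)) u v u0 v0.
have e1 : (a * q1 - m) ^+ 2 + (a * s1) ^+ 2 = u ^+ 2.
  have := congr1 (fun z => a ^+ 2 * z) ss1; rewrite /=.
  by lra.
have e2 : (b * q2 - m) ^+ 2 + (- (b * s2)) ^+ 2 = v ^+ 2.
  have := congr1 (fun z => b ^+ 2 * z) ss2; rewrite /=.
  by lra.
move=> /(_ e1 e2) cs.
have ab : 0 < 2 * a * b by rewrite !mulr_gt0.
by rewrite -(ler_pM2r ab) qE; lra.
Qed.

End PlanarAngles.

(** * Division of segments *)

Section Segments.
Context {R : realType} {X : metricType R}.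
Hypotheses (X_CAT0 : CAT0 X) (X_proper : proper_space X).
Implicit Types (p q : X) (c g : R -> X) (a b s t M : R).

Definition geodesic p q : R -> X := xget (fun=> p) [set c | geodesic_between p q c].

Definition segment_point p q s : X := geodesic p q (s * mdist p q).

Lemma geodesicP p q : geodesic_between p q (geodesic p q).
Proof.
by rewrite /geodesic; case: xgetP => // /(_ _) nex;
   case: X_CAT0 => /(_ p q)[c cpq]; case: (nex c).
Qed.

Lemma segment_point0 p q : segment_point p q 0 = p.
Proof. by rewrite /segment_point mul0r; case: (geodesicP p q). Qed.

Lemma segment_point1 p q : segment_point p q 1 = q.
Proof. by rewrite /segment_point mul1r; case: (geodesicP p q). Qed.

Lemma scaled_itv s a : 0 <= s <= 1 -> 0 <= a -> 0 <= s * a <= a.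
Proof. by move=> /andP[s0 s1] a0; rewrite mulr_ge0//= ler_piMl. Qed.

Lemma mdist_segment_point p q s t : 0 <= s <= 1 -> 0 <= t <= 1 ->
  mdist (segment_point p q s) (segment_point p q t) = `|s - t| * mdist p q.
Proof.
move=> s01 t01; have [ig _ _] := geodesicP p q.
rewrite (mdist_isometric_on ig) ?scaled_itv ?mdist_ge0//.
by rewrite -mulrBl normrM (ger0_norm (mdist_ge0 _ _)).
Qed.

Lemma mdist_segment_point_l p q s : 0 <= s <= 1 ->
  mdist p (segment_point p q s) = s * mdist p q.
Proof.
move=> s01; have h0 : 0 <= (0 : R) <= 1 by rewrite lexx ler01.
have := mdist_segment_point p q h0 s01; rewrite segment_point0 => ->.
by case/andP: s01 => s0 _; rewrite sub0r normrN ger0_norm.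
Qed.

Lemma mdist_segment_point_r p q s : 0 <= s <= 1 ->
  mdist (segment_point p q s) q = (1 - s) * mdist p q.
Proof.
move=> s01; have h1 : 0 <= (1 : R) <= 1 by rewrite lexx ler01.
have := mdist_segment_point p q s01 h1; rewrite segment_point1 => ->.
by case/andP: s01 => _ s1; rewrite distrC ger0_norm// subr_ge0.
Qed.

Lemma segment_point_convex p q p' q' s : 0 <= s <= 1 ->
  mdist (segment_point p q s) (segment_point p' q' s) <=
  (1 - s) * mdist p p' + s * mdist q q'.
Proof.
move=> s01; have [ig g0 g1] := geodesicP p q; have [ig' g0' g1'] := geodesicP p' q'.
have := mdist_convex X_CAT0 ig ig' (mdist_ge0 _ _) (mdist_ge0 _ _) s01.
by rewrite g0 g1 g0' g1'.
Qed.

End Segments.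

(** * Convergence to the boundary and joins *)

Section ConvergenceToBoundary.
Context {R : realType} {X : metricType R}.
Hypotheses (X_CAT0 : CAT0 X) (X_proper : proper_space X).
Context (U : set_system nat) (U_ultra : UltraFilter U) (U_oo : \oo `<=` U).
Implicit Types (p q : X) (c g : R -> X) (a b s t M : R) (u v : nat -> X).
Implicit Types (x y z : ideal_boundary X).

Definition escaping p u : Prop := forall M, \forall n \near U, M <= mdist p (u n).

(** Convergence along U in the cone topology at p. *)
Definition tends_to p u x : Prop :=
  exists (g : nat -> R -> X) (c : R -> X),
    [/\ forall n, geodesic_between p (u n) (g n), val x c &
        forall t, 0 <= t -> g n t @[n --> U] --> c t].

Lemma tends_to_exists p u : escaping p u -> exists x, tends_to p u x.
Proof.
move=> uoo; pose g n := geodesic p (u n).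
have gP n : geodesic_between p (u n) (g n) := geodesicP X_CAT0 p (u n).
have [|||c [rc c0 gc]] := @ulim_ray _ _ _ U_ultra X_proper g
  (fun n => mdist p (u n)) p.
- by move=> n; case: (gP n).
- by move=> n; case: (gP n).
- exact: uoo.
by have [x xc] := boundary_of_ray rc; exists x, g, c.
Qed.

(** A comparison angle at p of the far points that corresponds to a chord r
bounds the chord between their limits. *)
Lemma tends_to_chord p u v x y r : 0 <= r -> escaping p u -> escaping p v ->
  tends_to p u x -> tends_to p v y ->
  (\forall n \near U, mdist (u n) (v n) ^+ 2 <=
     mdist p (u n) ^+ 2 + mdist p (v n) ^+ 2 -
     mdist p (u n) * mdist p (v n) * (2 - r ^+ 2)) ->
  chord_le x y r.
Proof.
move=> r0 uoo voo [g [c [gP xc gc]]] [g' [c' [gP' yc' gc']]] h.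
have ge n : g n (mdist p (u n)) = u n by case: (gP n).
have ge' n : g' n (mdist p (v n)) = v n by case: (gP' n).
apply: (@chord_le_ulim _ _ X_CAT0 U g g' (fun n => mdist p (u n))
   (fun n => mdist p (v n)) p x y c c' r U_ultra r0) => //.
- by move=> n; case: (gP n).
- by move=> n; case: (gP n).
- by move=> n; case: (gP' n).
- by move=> n; case: (gP' n).
by apply: filterS h => n; rewrite ge ge'.
Qed.

Lemma tends_to_ray x c : val x c -> tends_to (c 0) (fun n => c n%:R) x.
Proof.
move=> xc; have rc := boundary_rays xc; exists (fun=> c), c; split => //.
- by move=> n; apply: isometric_on_geodesic => //; exact: ray_isometric_on.
- by move=> t _; exact: cvg_cst.
Qed.

Lemma escaping_ray c : rays c -> escaping (c 0) (fun n => c n%:R).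
Proof.
move=> rc M; have /U_oo := nbhs_infty_ger M.
by apply: filterS => n; rewrite mdist_ray0.
Qed.

Lemma chord_le0_eq x y : chord_le x y 0 -> x = y.
Proof.
move=> h; have [c _ xE] := set_valP x; pose p := c 0.
have xk := ray_to_val X_CAT0 X_proper p x.
have yk := ray_to_val X_CAT0 X_proper p y.
apply: (@boundary_eq _ _ _ _ (ray_to p x)) => //.
apply: (boundary_closed yk (boundary_rays xk)).
exists 0 => t t0; rewrite -(mul0r t) metric_sym; apply: h => //.
by rewrite !(ray_to0 X_CAT0 X_proper).
Qed.

Lemma tends_to_unique p u x y : escaping p u ->
  tends_to p u x -> tends_to p u y -> x = y.
Proof.
move=> uoo ux uy; apply: chord_le0_eq.
apply: (tends_to_chord (lexx _) uoo uoo ux uy).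
by apply: nearW => n; rewrite mdistxx; nra.
Qed.

(** The segments are divided by length and not by angle: continuity in s and
in the ends then follows from the convexity of the metric. *)
Definition joining_points p x y s (n : nat) : X :=
  segment_point (ray_to p x n%:R) (ray_to p y n%:R) s.

(** A path from x to y in the boundary as s runs from 0 to 1. Taking the limits
of all joining points along one ultrafilter makes the joins of different points
comparable. *)
Definition join p x y s : ideal_boundary X :=
  xget x [set z | tends_to p (joining_points p x y s) z].

Lemma chord_le_ray_to p x y r t : chord_le x y r -> 0 <= t ->
  mdist (ray_to p x t) (ray_to p y t) <= r * t.
Proof.
move=> h t0; apply: h => //; try exact: ray_to_val.
by rewrite !(ray_to0 X_CAT0 X_proper).
Qed.

Lemma mdist_ray_to p x t : 0 <= t -> mdist p (ray_to p x t) = t.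
Proof.
move=> t0; have := mdist_ray0 (ray_to_ray X_CAT0 X_proper p x) t0.
by rewrite (ray_to0 X_CAT0 X_proper).
Qed.

(** One end of the segment is at most half of its length away. *)
Lemma joining_points_far p x y r s n : chord_le x y r -> r <= 3 / 2 ->
  0 <= s <= 1 -> n%:R / 4 <= mdist p (joining_points p x y s n).
Proof.
move=> h r32 s01; rewrite /joining_points.
have n0 : 0 <= n%:R :> R by [].
have h1 := mdist_ray_to p x n0; have h2 := mdist_ray_to p y n0.
have hd := chord_le_ray_to p h n0.
have hl := mdist_segment_point_l X_CAT0 (ray_to p x n%:R) (ray_to p y n%:R) s01.
have hr := mdist_segment_point_r X_CAT0 (ray_to p x n%:R) (ray_to p y n%:R) s01.
set m := segment_point _ _ _ in hl hr *.
have t1 := metric_triangle p m (ray_to p x n%:R).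
have t2 := metric_triangle p m (ray_to p y n%:R).
rewrite metric_sym (metric_sym m) in t1.
rewrite (metric_sym _ p) in t1.
have := ler_wpM2r n0 r32.
by lra.
Qed.

Lemma joining_points_escaping p x y r s : chord_le x y r -> r <= 3 / 2 ->
  0 <= s <= 1 -> escaping p (joining_points p x y s).
Proof.
move=> h r32 s01 M; have /U_oo := nbhs_infty_ger (4 * M).
apply: filterS => n /= hn; apply: le_trans (joining_points_far p n h r32 s01).
by lra.
Qed.

Lemma join_tends_to p x y r s : chord_le x y r -> r <= 3 / 2 ->
  0 <= s <= 1 -> tends_to p (joining_points p x y s) (join p x y s).
Proof.
move=> h r32 s01; rewrite /join; case: xgetP => [z _ //|nex].
have [z hz] := tends_to_exists (joining_points_escaping p h r32 s01).
by case: (nex z).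
Qed.

Lemma join0 p x y r : chord_le x y r -> r <= 3 / 2 -> join p x y 0 = x.
Proof.
move=> h r32; have s01 : 0 <= (0 : R) <= 1 by rewrite lexx ler01.
apply: (tends_to_unique (joining_points_escaping p h r32 s01)).
  exact: join_tends_to h r32 s01.
have -> : joining_points p x y 0 = (fun n => ray_to p x n%:R).
  by apply/funext => n; exact: segment_point0.
rewrite -{1}(ray_to0 X_CAT0 X_proper p x); apply: tends_to_ray.
exact: ray_to_val.
Qed.

Lemma join1 p x y r : chord_le x y r -> r <= 3 / 2 -> join p x y 1 = y.
Proof.
move=> h r32; have s01 : 0 <= (1 : R) <= 1 by rewrite lexx ler01.
apply: (tends_to_unique (joining_points_escaping p h r32 s01)).
  exact: join_tends_to h r32 s01.
have -> : joining_points p x y 1 = (fun n => ray_to p y n%:R).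
  by apply/funext => n; exact: segment_point1.
rewrite -{1}(ray_to0 X_CAT0 X_proper p y); apply: tends_to_ray.
exact: ray_to_val.
Qed.

(** Both joining points are at distance at least n / 4 from p, so the chord
between their directions is at most four times their distance over n. *)
Lemma join_chord p x x' y (r a : R) s s' :
  chord_le x y r -> chord_le x' y r -> r <= 3 / 2 -> 0 <= a -> chord_le x x' a ->
  0 <= s <= 1 -> 0 <= s' <= 1 ->
  chord_le (join p x y s) (join p x' y s') (4 * (a + `|s - s'| * (3 / 2))).
Proof.
move=> h h' r32 a0 xx' s01 s01'.
set sg := a + _; have sg0 : 0 <= sg by rewrite addr_ge0// mulr_ge0.
apply: (@tends_to_chord p (joining_points p x y s) (joining_points p x' y s')).
- by rewrite mulr_ge0.
- exact: joining_points_escaping h r32 s01.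
- exact: joining_points_escaping h' r32 s01'.
- exact: join_tends_to h r32 s01.
- exact: join_tends_to h' r32 s01'.
apply: nearW => n; have n0 : 0 <= n%:R :> R by [].
have f1 := joining_points_far p n h r32 s01.
have f2 := joining_points_far p n h' r32 s01'.
have : mdist (joining_points p x y s n) (joining_points p x' y s' n) <= sg * n%:R.
  apply: le_trans (metric_triangle _ (joining_points p x' y s n) _) _.
  rewrite mulrDl; apply: lerD.
    apply: le_trans (segment_point_convex X_CAT0 _ _ _ _ s01) _.
    rewrite mdistxx mulr0 addr0; apply: le_trans (chord_le_ray_to p xx' n0).
    by case/andP: s01 => s0 _; rewrite ler_piMl ?mdist_ge0// lerBlDr lerDl.
  rewrite mdist_segment_point// -mulrA ler_wpM2l//.
  by apply: le_trans (chord_le_ray_to p h' n0) _; exact: ler_wpM2r.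
move: f1 f2; set D := mdist p _; set D' := mdist p _; set e := mdist _ _.
move=> f1 f2 he.
have e0 : 0 <= e := mdist_ge0 _ _.
have e2 : e ^+ 2 <= (sg * n%:R) ^+ 2.
  by rewrite ler_pXn2r ?nnegrE ?mulr_ge0.
have DD : n%:R ^+ 2 / 16 <= D * D'.
  have -> : n%:R ^+ 2 / 16 = (n%:R / 4) * (n%:R / 4) :> R by field.
  by apply: ler_pM => //; rewrite divr_ge0.
have := ler_wpM2l (sqr_ge0 sg) DD.
by have := sqr_ge0 (D - D'); lra.
Qed.

End ConvergenceToBoundary.

(** * Topologies given by distances *)

Section DistSpace.
Context {R : realType} {T : Type} (d : T -> T -> \bar R).

Lemma dist_space_cvg {S : Type} (F : set_system S) (FF : Filter F)
    (h : S -> dist_space d) (y : dist_space d) :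
  (forall e : R, 0 < e -> \forall z \near F, (d y (h z) < e%:E)%E) ->
  h z @[z --> F] --> y.
Proof.
move=> H W; rewrite nbhsE => -[V [oV Vy] VW].
have [e e0 eV] : exists2 e : R, 0 < e & forall z, (d y z < e%:E)%E -> V z.
  exact: oV y Vy.
by apply: filterS (H e e0) => z /eV/VW.
Qed.

Lemma dist_space_nbhs (y : dist_space d) (V : set (dist_space d)) : V y ->
  (forall x, V x -> exists2 e : R, 0 < e & forall z, (d x z < e%:E)%E -> V z) ->
  nbhs y V.
Proof. by move=> Vy oV; rewrite nbhsE; exists V. Qed.

End DistSpace.

(** * The Tits metric *)

Section TitsMetric.
Context {R : realType} {X : metricType R}.
Hypotheses (X_CAT0 : CAT0 X) (X_proper : proper_space X).
Implicit Types (p q : X) (x y z : ideal_boundary X) (a b r s t M : R).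

Lemma chord_angle_small (e : R) : 0 < e ->
  exists2 r0 : R, 0 < r0 <= 1 &
    forall r, 0 <= r <= r0 -> acos (1 - r ^+ 2 / 2) < e.
Proof.
move=> e0; pose e' : R := Num.min (e / 2) pi.
have e'0 : 0 < e' by rewrite lt_min divr_gt0// pi_gt0.
have e'pi : e' <= pi by rewrite ge_min lexx orbT.
have e'e : e' < e.
  have : e' <= e / 2 by rewrite ge_min lexx.
  by lra.
have c1 : cos e' < 1.
  rewrite -(@cos0 R) ltr_cos// in_itv/= ?lexx ?pi_ge0//.
  by rewrite ltW.
exists (Num.min 1 (1 - cos e')).
  by rewrite lt_min ltr01 subr_gt0 c1 ge_min lexx.
move=> r /andP[r0]; rewrite le_min => /andP[r1 rc].
apply: le_lt_trans e'e; apply: acos_le_of_cos.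
- by apply: chord_cos_itv; rewrite r0; lra.
- by rewrite e'pi ltW.
- by nra.
Qed.

Lemma Td_ge_ideal_angle x y (e : R) : (Td x y < e%:E)%E -> ideal_angle x y < e.
Proof.
rewrite /Td /length_metric => /ereal_inf_lt[_ [g [_ [g0 g1]] <-]] ge.
rewrite -lte_fin; apply: le_lt_trans ge; rewrite /path_length.
apply: le_ereal_sup_tmp; exists (ideal_angle x y)%:E => //.
exists [:: 1]; first exact: itv_partition1.
by rewrite big_ord_recl big_ord0/= addr0 g0 g1.
Qed.

Context (U : set_system nat) (U_ultra : UltraFilter U) (U_oo : \oo `<=` U).

(** A comparison angle that is smaller along U would give a shorter chord,
hence a smaller ideal angle. *)
Lemma ideal_angle_le_comparison p u v x y (e : R) :
  escaping U p u -> escaping U p v -> tends_to U p u x -> tends_to U p v y ->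
  0 < e ->
  \forall n \near U, ideal_angle x y <= comparison_angle p (u n) (v n) + e.
Proof.
move=> uoo voo ux vy e0; pose I := ideal_angle x y.
have [//|Un] := in_ultra_setVsetC
  [set n | I <= comparison_angle p (u n) (v n) + e] U_ultra.
exfalso; pose B := I - e.
have {Un} Un : \forall n \near U, comparison_angle p (u n) (v n) < B.
  by apply: filterS Un => n /negP; rewrite /B -ltNge; lra.
have [n nB] := filter_ex Un.
have B0 : 0 < B := le_lt_trans (comparison_angle_ge0 _ _ _) nB.
have Bpi : B <= pi.
  have : I <= pi by apply: (ideal_angle_le p) => q; exact: angle_lepi.
  by rewrite /B; lra.
have Bitv : B \in `[0, pi] by rewrite in_itv/= (ltW B0).
have c1 := cos_le1 B; have cN1 := cos_geN1 B.
pose r := Num.sqrt (2 - 2 * cos B).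
have r2 : r ^+ 2 = 2 - 2 * cos B by rewrite sqr_sqrtr//; lra.
have r0 : 0 <= r by exact: sqrtr_ge0.
have rle2 : r <= 2 by rewrite -(@ler_pXn2r _ 2) ?nnegrE// r2; lra.
suff /(chord_le_ideal_angle X_CAT0 X_proper p) : chord_le x y r.
  rewrite r0 rle2 r2 => /(_ isT).
  rewrite (_ : 1 - _ / 2 = cos B); last by field.
  by rewrite cosK// /B -/I; lra.
apply: (tends_to_chord X_CAT0 U_ultra r0 uoo voo ux vy).
apply: filterS3 Un (uoo 1) (voo 1) => k kB u1 v1.
have D0 : 0 < 2 * mdist p (u k) * mdist p (v k) by rewrite !mulr_gt0//; lra.
have : cos B <= (mdist p (u k) ^+ 2 + mdist p (v k) ^+ 2 - mdist (u k) (v k) ^+ 2) /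
        (2 * mdist p (u k) * mdist p (v k)).
  rewrite leNgt; apply/negP => hlt; move: kB; rewrite ltNge => /negP; apply.
  rewrite -[leLHS]cosK//; apply: acos_le.
  - exact: mdist_cos_ratio_itv.
  - by rewrite cN1 c1.
  - exact: ltW.
by rewrite ler_pdivlMr// r2; lra.
Qed.

Lemma joining_points_superadditive p x y r a b c : chord_le x y r -> r <= 3 / 2 ->
  0 <= a -> a <= b -> b <= c -> c <= 1 ->
  \forall n \near U,
    comparison_angle p (joining_points p x y a n) (joining_points p x y b n) +
    comparison_angle p (joining_points p x y b n) (joining_points p x y c n) <=
    comparison_angle p (joining_points p x y a n) (joining_points p x y c n).
Proof.
move=> h r32 a0 ab bc c1.
have ha : 0 <= a <= 1 by apply/andP; split; lra.
have hb : 0 <= b <= 1 by apply/andP; split; lra.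
have hc : 0 <= c <= 1 by apply/andP; split; lra.
apply: filterS (U_oo (nbhs_infty_ger 1)) => n n1.
have fa := joining_points_far X_CAT0 X_proper p n h r32 ha.
have fb := joining_points_far X_CAT0 X_proper p n h r32 hb.
have fc := joining_points_far X_CAT0 X_proper p n h r32 hc.
rewrite /comparison_angle.
set A := joining_points p x y a n in fa *.
set B := joining_points p x y b n in fb *.
set C := joining_points p x y c n in fc *.
have eAC : mdist A C = mdist A B + mdist B C.
  rewrite /A /B /C /joining_points !(mdist_segment_point X_CAT0)//.
  rewrite -mulrDl; congr (_ * _).
  rewrite (distrC a c) (distrC a b) (distrC b c) !ger0_norm ?subr_ge0//; last by lra.
  by ring.
have := @planar_angle_superadditive R (mdist p A) (mdist p C) (mdist p B)
  (mdist A B) (mdist B C).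
rewrite /planar_angle -eAC; apply; rewrite ?mdist_ge0//.
- by lra.
- by lra.
- by lra.
- by rewrite (metric_sym A B); exact: metric_triangle.
- exact: metric_triangle.
- by rewrite (metric_sym p A); exact: metric_triangle.
- exact: metric_triangle.
- by rewrite (metric_sym B C); exact: metric_triangle.
- by rewrite addrC (metric_sym p B); exact: metric_triangle.
- by rewrite (metric_sym A C); exact: metric_triangle.
- exact: metric_triangle.
- by rewrite (metric_sym p A); exact: metric_triangle.
Qed.

(** Along the joining points the comparison angles add up superadditively, so
the angular length of any chain of joins stays below the whole angle. *)
Lemma join_length_le p x y r a (l : seq R) (e : R) : chord_le x y r -> r <= 3 / 2 ->
  0 < e -> 0 <= a -> path <%R a l -> last a l <= 1 ->
  \forall n \near U,
    \sum_(i < size l) ideal_angle (join U p x y (nth 0 (a :: l) i))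
                                  (join U p x y (nth 0 l i)) <=
    comparison_angle p (joining_points p x y a n)
                       (joining_points p x y (last a l) n) + e * (size l)%:R.
Proof.
move=> h r32 e0; elim: l a => [a a0 _ _|b l IH a a0 /= /andP[ab bl] l1].
  apply: nearW => n; rewrite big_ord0 mulr0 addr0.
  exact: comparison_angle_ge0.
have b0 : 0 <= b by lra.
have bl1 : b <= last b l.
  elim: (l) (b) bl => //= k l' IH' b' /andP[bk kl].
  by rewrite (le_trans (ltW bk))// IH'.
have ha : 0 <= a <= 1 by apply/andP; split; lra.
have hb : 0 <= b <= 1 by apply/andP; split; lra.
have I := ideal_angle_le_comparison
  (joining_points_escaping X_CAT0 X_proper U_ultra U_oo p h r32 ha)
  (joining_points_escaping X_CAT0 X_proper U_ultra U_oo p h r32 hb)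
  (join_tends_to X_CAT0 X_proper U_ultra U_oo p h r32 ha)
  (join_tends_to X_CAT0 X_proper U_ultra U_oo p h r32 hb) e0.
apply: filterS3 (IH b b0 bl l1) I
  (joining_points_superadditive p h r32 a0 (ltW ab) bl1 l1) => n h1 h2 h3.
rewrite big_ord_recl /= -natr1 mulrDr mulr1.
by lra.
Qed.

(** Joins form a path of length at most the comparison angle at p of points
far out on the two rays. The bound on r keeps the joining points away from p. *)
Lemma Td_le p x y r : 0 <= r -> r ^+ 2 <= 2 -> chord_le x y r ->
  (Td x y <= (acos (1 - r ^+ 2 / 2))%:E)%E.
Proof.
move=> r0 r2 h.
have r32 : r <= 3 / 2 by rewrite -(@ler_pXn2r _ 2) ?nnegrE//; lra.
pose g s := join U p x y s.
apply: ge_ereal_inf; exists (path_length (@ideal_angle R X) g).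
  exists g => //; split; last split.
  - apply/subspace_continuousP => s /= s01.
    apply: dist_space_cvg => e e0.
    have [r1 /andP[r10 r11] r1P] := chord_angle_small e0.
    have r16 : 0 < r1 / 6 by rewrite divr_gt0.
    rewrite near_withinE; near=> t => t01.
    have st : `|s - t| < r1 / 6 by near: t; exact: nbhsx_ballx.
    rewrite lte_fin; move: s01 t01; rewrite /= !in_itv/= => s01 t01.
    have := join_chord X_CAT0 X_proper U_ultra U_oo (p := p) h h r32 (lexx 0)
      (@chord_le_refl R X X_CAT0 x) s01 t01.
    rewrite add0r => /(chord_le_ideal_angle X_CAT0 X_proper p) hh.
    have st0 : 0 <= `|s - t| by [].
    have itv : 0 <= 4 * (`|s - t| * (3 / 2)) <= r1 by apply/andP; split; lra.
    have itv2 : 0 <= 4 * (`|s - t| * (3 / 2)) <= 2 by apply/andP; split; lra.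
    by apply: le_lt_trans (hh itv2) _; exact: r1P.
  - exact: (join0 X_CAT0 X_proper U_ultra U_oo p h r32).
  - exact: (join1 X_CAT0 X_proper U_ultra U_oo p h r32).
apply: ge_ereal_sup => _ [l [pl /eqP ll] <-]; rewrite lee_fin.
apply/ler_addgt0Pl => /= e e0.
pose e' : R := e / (size l).+1%:R.
have e'0 : 0 < e' by rewrite divr_gt0.
have := join_length_le p h r32 e'0 (lexx 0) pl.
rewrite ll => /(_ (lexx _)) hl.
have hl1 : \forall n \near U, 1 <= n%:R :> R := U_oo (nbhs_infty_ger 1).
have [n [hn n1]] := filter_ex (@filterI _ U _ _ _ hl hl1).
apply: le_trans hn _; rewrite [leRHS]addrC; apply: lerD.
  rewrite /joining_points segment_point0// segment_point1//.
  rewrite /comparison_angle !(mdist_ray_to X_CAT0 X_proper)//.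
  have n0 : 0 <= n%:R :> R by [].
  have hd := chord_le_ray_to X_CAT0 X_proper p h n0.
  apply: acos_le.
  - by apply: chord_cos_itv; rewrite r0; lra.
  - have := mdist_cos_ratio_itv p (ray_to p x n%:R) (ray_to p y n%:R).
    by rewrite !(mdist_ray_to X_CAT0 X_proper).
  - have {}hd : mdist (ray_to p x n%:R) (ray_to p y n%:R) ^+ 2 <= (r * n%:R) ^+ 2.
      by rewrite ler_pXn2r ?nnegrE ?mdist_ge0// mulr_ge0.
    by rewrite ler_pdivlMr ?mulr_gt0//; lra.
rewrite /e' mulrAC ler_pdivrMr// ler_wpM2l// ?(ltW e0)// ler_nat.
Unshelve. all: by end_near. Qed.

End TitsMetric.

(** * Isometries and their fixed points at infinity *)

Section Isometries.
Context {R : realType} {X : metricType R}.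
Hypotheses (X_CAT0 : CAT0 X) (X_proper : proper_space X).
Context (f : X -> X) (f_isom : is_isometry f).
Implicit Types (p q : X) (c g : R -> X) (a b s t M : R) (x y z : ideal_boundary X).

Lemma isometryE p q : mdist (f p) (f q) = mdist p q.
Proof. by case: f_isom. Qed.

Lemma isometry_isometric_on (I : set R) c :
  isometric_on I c -> isometric_on I (fun t => f (c t)).
Proof. by move=> ic s t Is It; rewrite isometryE ic. Qed.

Lemma isometry_cvg (U : set_system nat) (u : nat -> X) p : Filter U ->
  u n @[n --> U] --> p -> f (u n) @[n --> U] --> f p.
Proof.
move=> FU up W /nbhs_ballP[e /= e0 eW].
have h : \forall n \near U, mdist p (u n) < e := ulim_mdist_lt up e0.
by apply: filterS h => n /= h; apply: eW; rewrite ballEmdist/= isometryE.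
Qed.

Lemma displacement_segment p q s : 0 <= s <= 1 ->
  mdist (segment_point p q s) (f (segment_point p q s)) <=
  (1 - s) * mdist p (f p) + s * mdist q (f q).
Proof.
move=> s01; have [ig g0 g1] := geodesicP X_CAT0 p q.
have := mdist_convex X_CAT0 ig (isometry_isometric_on ig)
  (mdist_ge0 _ _) (mdist_ge0 _ _) s01.
by rewrite g0 g1.
Qed.

Lemma fixed_point_val x c : ideal_fixed_points f x -> val x c ->
  val x (fun t => f (c t)).
Proof.
move=> fx xc; have {}fx : [set (fun t => f (k t)) | k in val x] = val x := fx.
have : [set (fun t => f (k t)) | k in val x] (fun t => f (c t)) by exists c.
by rewrite fx.
Qed.

(** One ray of the class that stays close to its image suffices; that every ray
of the class is itself an image comes from the inverse of f. *)
Lemma fixed_point_of_ray x c : val x c -> asymptotic c (fun t => f (c t)) ->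
  ideal_fixed_points f x.
Proof.
move=> xc [M cM]; have [[h hK Kh] _] := f_isom.
have disp k t : val x k -> 0 <= t ->
    mdist (k t) (f (k t)) <= mdist (k 0) (c 0) + M + mdist (k 0) (c 0).
  move=> xk t0; have d := boundary_mdist_le X_CAT0 xk xc t0.
  have := metric_triangle (k t) (c t) (f (k t)).
  have := metric_triangle (c t) (f (c t)) (f (k t)).
  by rewrite isometryE (metric_sym (c t) (k t)); have := cM t t0; lra.
apply/seteqP; split => [_ [k xk <-]|k xk].
  apply: (boundary_closed xk).
    exact/isometry_isometric_on/boundary_rays/xk.
  by exists (mdist (k 0) (c 0) + M + mdist (k 0) (c 0)) => t; exact: disp.
exists (fun t => h (k t)); last by apply/funext => t; rewrite Kh.
apply: (boundary_closed xk).
  move=> s t Is It; rewrite -(boundary_rays xk Is It).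
  by rewrite -[in RHS](Kh (k s)) -[in RHS](Kh (k t)) isometryE.
exists (mdist (k 0) (c 0) + M + mdist (k 0) (c 0)) => t t0.
by rewrite metric_sym -(isometryE (h (k t))) Kh; exact: disp.
Qed.

(** The image of the ray is asymptotic to it. *)
Lemma displacement_ray_le x c t : ideal_fixed_points f x -> val x c -> 0 <= t ->
  mdist (c t) (f (c t)) <= mdist (c 0) (f (c 0)).
Proof.
by move=> fx xc t0; exact: (boundary_mdist_le X_CAT0 xc (fixed_point_val fx xc) t0).
Qed.

Context (U : set_system nat) (U_ultra : UltraFilter U) (U_oo : \oo `<=` U).

Lemma tends_to_fixed p (u : nat -> X) x M :
  escaping U p u -> tends_to U p u x ->
  (\forall n \near U, mdist (u n) (f (u n)) <= M) -> ideal_fixed_points f x.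
Proof.
move=> uoo [g [c [gP xc gc]]] uM; apply: (fixed_point_of_ray xc).
exists (2 * (mdist p (f p) + M)) => t t0.
apply: (mdist_ulim_le U_ultra (gc t t0) (isometry_cvg _ (gc t t0))).
apply: filterS2 (uoo t) uM => n tn hn.
have [ig g0 g1] := gP n.
apply: (geodesic_fellow X_CAT0 ig (isometry_isometric_on ig)) => //.
- by rewrite g0.
- by rewrite g1.
- by rewrite t0.
Qed.

Lemma join_fixed p x y r s : chord_le x y r -> r <= 3 / 2 -> 0 <= s <= 1 ->
  ideal_fixed_points f x -> ideal_fixed_points f y ->
  ideal_fixed_points f (join U p x y s).
Proof.
move=> h r32 s01 fx fy.
apply: (@tends_to_fixed p (joining_points p x y s) _ (mdist p (f p))).
- exact: joining_points_escaping h r32 s01.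
- exact: join_tends_to h r32 s01.
apply: nearW => n; have n0 : 0 <= n%:R :> R by [].
apply: le_trans (displacement_segment _ _ s01) _.
have hx := displacement_ray_le fx (ray_to_val X_CAT0 X_proper p x) n0.
have hy := displacement_ray_le fy (ray_to_val X_CAT0 X_proper p y) n0.
rewrite ray_to0// in hx; rewrite ray_to0// in hy.
by case/andP: s01 => s0 s1; nra.
Qed.

Lemma mdist_iter (n : nat) p q : mdist (iter n f p) (iter n f q) = mdist p q.
Proof. by elim: n => //= n <-; rewrite isometryE. Qed.

Lemma mdist_iter_le (n : nat) p : mdist p (iter n f p) <= n%:R * mdist p (f p).
Proof.
elim: n => [|n IH]; first by rewrite mdistxx mul0r.
apply: le_trans (metric_triangle _ (iter n f p) _) _.
by rewrite -natr1 mulrDl mul1r lerD// iterSr mdist_iter.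
Qed.

End Isometries.

(** * Isometries whose displacement attains its infimum *)

Section Axis.
Context {R : realType} {X : metricType R}.
Hypotheses (X_CAT0 : CAT0 X).
Implicit Types (p q : X) (c g : R -> X) (f h : X -> X) (s t : R).

Lemma iter_cancel (f h : X -> X) n : cancel f h -> cancel (iter n f) (iter n h).
Proof. by move=> fh; elim: n => // n IH q; rewrite iterSr iterS fh IH. Qed.

Lemma is_isometry_iter f n : is_isometry f -> is_isometry (iter n f).
Proof.
move=> fi; have [[h fh hf] _] := fi.
split; last by move=> x y; rewrite (mdist_iter fi).
by exists (iter n h); exact: iter_cancel.
Qed.

(** The segment between the midpoints of p, f p and of f p, f (f p) is at most
half as long as the one from p to f (f p). *)
Lemma displacement_double f (l : R) : is_isometry f ->
  (forall p, l <= mdist p (f p)) -> forall p, 2 * l <= mdist p (f (f p)).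
Proof.
move=> fi fl p; have [ig g0 g1] := geodesicP X_CAT0 p (f p).
set g := geodesic _ _ in ig g0 g1; pose D := mdist p (f p).
have D0 : 0 <= D := mdist_ge0 _ _.
have h : 0 <= (2^-1 : R) <= 1 by lra.
have := hinge_scaled X_CAT0 (isometric_on_rev ig) (isometry_isometric_on fi ig)
  (_ : g (D - 0) = f (g 0)) D0 D0 h.
rewrite -/D subr0 subrr g0 g1 => /(_ erefl).
rewrite (_ : D - 2^-1 * D = 2^-1 * D); last by field.
by have := fl (g (2^-1 * D)); lra.
Qed.

Lemma displacement_pow2 f (l : R) k : is_isometry f ->
  (forall p, l <= mdist p (f p)) ->
  forall p, 2 ^+ k * l <= mdist p (iter (2 ^ k) f p).
Proof.
move=> fi fl; elim: k => [|k IH] p; first by rewrite mul1r.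
have := displacement_double (is_isometry_iter (2 ^ k) fi) IH p.
by rewrite -iterD addnn -mul2n -expnS mulrA -exprS.
Qed.

(** The orbit of p moves as far as possible in 2 ^ n steps, by doubling, so there
is no shortcut between any two of its points on the way. *)
Lemma mdist_iter_min f (l : R) p n : is_isometry f ->
  (forall q, l <= mdist q (f q)) -> mdist p (f p) = l ->
  mdist p (iter n f p) = n%:R * l.
Proof.
move=> fi fl pl; apply/eqP; rewrite eq_le -{1}pl mdist_iter_le//=.
have n2 : (n <= 2 ^ n)%N by rewrite ltnW// ltn_expl.
have := displacement_pow2 n fi fl p.
rewrite -[X in iter X](subnKC n2) iterD.
have := metric_triangle p (iter n f p) (iter n f (iter (2 ^ n - n) f p)).
rewrite (mdist_iter fi).
have := mdist_iter_le fi (2 ^ n - n) p; rewrite pl natrB// natrX.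
by lra.
Qed.

(** The images under the iterates of f of a segment from p to f p fit together
to a ray, and pulling this ray back gives the axis. *)
Lemma attained_displacement f p : is_isometry f ->
  (forall q, mdist p (f p) <= mdist q (f q)) -> elliptic f \/ hyperbolic f.
Proof.
move=> fi fl; have [l_le0|l0] := leP (mdist p (f p)) 0.
  left; exists p; apply/esym/mdist_positivity/eqP.
  by rewrite eq_le l_le0 mdist_ge0.
right; set l := mdist p (f p) in l0 fl.
have nl0 : l != 0 by rewrite gt_eqF.
have [ig g0 g1] := geodesicP X_CAT0 p (f p).
set g := geodesic _ _ in ig g0 g1; rewrite -/l in ig g1.
(* P i r is the point of the ray at time i l + r. *)
pose P i r := iter i f (g r).
have iterE n : mdist p (iter n f p) = n%:R * l by exact: mdist_iter_min.
have P0 i : P i 0 = iter i f p by rewrite /P g0.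
have Pl i : P i l = iter i.+1 f p by rewrite /P g1 iterSr.
have dP i r r' : 0 <= r <= l -> 0 <= r' <= l -> mdist (P i r) (P i r') = `|r - r'|.
  by move=> hr hr'; rewrite (mdist_iter fi) (mdist_isometric_on ig).
have l01 : 0 <= (0 : R) <= l by rewrite lexx ltW.
have l11 : 0 <= l <= l by rewrite lexx ltW.
have dPlt i j r r' : (i < j)%N -> 0 <= r <= l -> 0 <= r' <= l ->
    mdist (P i r) (P j r') = `|(i%:R * l + r) - (j%:R * l + r')|.
  move=> ij hr hr'; have /andP[r0 rl] := hr; have /andP[r0' rl'] := hr'.
  have h1 : mdist (P i r) (iter i.+1 f p) = l - r.
    by rewrite -Pl dP// distrC ger0_norm ?subr_ge0.
  have h2 : mdist (iter j f p) (P j r') = r'.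
    by rewrite -P0 dP// sub0r normrN ger0_norm.
  have h3 : mdist (P j r') (iter j.+1 f p) = l - r'.
    by rewrite -Pl dP// distrC ger0_norm ?subr_ge0.
  have h4 : mdist (iter i f p) (P i r) = r.
    by rewrite -P0 dP// sub0r normrN ger0_norm.
  have h5 : mdist (iter i.+1 f p) (iter j f p) = (j%:R - i.+1%:R) * l.
    by rewrite -(subnKC ij) iterD (mdist_iter fi) iterE natrD addrAC subrr add0r.
  have t1 := metric_triangle (P i r) (iter i.+1 f p) (P j r').
  have t2 := metric_triangle (iter i.+1 f p) (iter j f p) (P j r').
  have t3 := metric_triangle p (P i r) (iter j.+1 f p).
  have t4 := metric_triangle (P i r) (P j r') (iter j.+1 f p).
  have t5 := metric_triangle p (iter i f p) (P i r).
  rewrite iterE -natr1 in t3; rewrite iterE in t5; rewrite -natr1 in h5.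
  have -> : mdist (P i r) (P j r') = (j%:R * l + r') - (i%:R * l + r) by lra.
  rewrite distrC ger0_norm// -/(P i r).
  by have := mdist_ge0 (P i r) (P j r'); lra.
have dPall i j r r' : 0 <= r <= l -> 0 <= r' <= l ->
    mdist (P i r) (P j r') = `|(i%:R * l + r) - (j%:R * l + r')|.
  move=> hr hr'; case: (ltngtP i j) => [ij|ji|<-]; first exact: dPlt.
    by rewrite metric_sym dPlt// distrC.
  by rewrite dP//; congr (`| _ |); ring.
pose N t := Num.truncn (t / l).
have Nitv t : 0 <= t -> 0 <= t - (N t)%:R * l <= l.
  move=> t0; have := @Num.Theory.truncn_itv R (t / l).
  rewrite divr_ge0 ?(ltW l0)// => /(_ isT)/andP[].
  by rewrite ler_pdivlMr// ltr_pdivrMr// -natr1 => h1 h2; apply/andP; split; lra.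
pose k t := P (N t) (t - (N t)%:R * l).
have kray s t : 0 <= s -> 0 <= t -> mdist (k s) (k t) = `|s - t|.
  by move=> s0 t0; rewrite dPall ?Nitv//; congr (`| _ |); ring.
have kf t : 0 <= t -> f (k t) = k (t + l).
  move=> t0; rewrite /k (_ : N (t + l) = (N t).+1).
    by rewrite /P -natr1 iterS; congr (f (iter _ f (g _))); ring.
  apply: Num.Theory.truncn_def.
  have := @Num.Theory.truncn_itv R (t / l).
  rewrite divr_ge0 ?(ltW l0)// => /(_ isT)/andP[].
  by rewrite mulrDl divff// -!natr1 -/(N t) => h1 h2; apply/andP; split; lra.
have kfn n t : 0 <= t -> iter n f (k t) = k (t + n%:R * l).
  move=> t0; elim: n => [|n IH] /=; first by rewrite mul0r addr0.
  rewrite IH kf; last by rewrite addr_ge0// mulr_ge0// ltW.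
  by rewrite -natr1; congr k; ring.
have [[h fh hf] _] := fi.
have hfn n q : iter n h (iter n f q) = q.
  exact: iter_cancel.
(* Enough iterations to move the time t into the domain of the ray k. *)
pose K t := (N `|t|).+1.
have Kge t : 0 <= t + (K t)%:R * l.
  have := @Num.Theory.truncn_itv R (`|t| / l).
  rewrite divr_ge0 ?(ltW l0)// => /(_ isT)/andP[_].
  rewrite -/(N `|t|) -/(K t) ltr_pdivrMr//.
  by have := ler_norm (- t); rewrite normrN; lra.
pose c t := iter (K t) h (k (t + (K t)%:R * l)).
have cE n t : 0 <= t + n%:R * l -> c t = iter n h (k (t + n%:R * l)).
  have shift i j : 0 <= t + i%:R * l ->
      iter (i + j) h (k (t + (i + j)%:R * l)) = iter i h (k (t + i%:R * l)).
    move=> ti; rewrite iterD (_ : k _ = iter j f (k (t + i%:R * l))) ?hfn//.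
    by rewrite kfn// natrD; congr k; ring.
  by move=> tn; rewrite /c -(shift _ n (Kge t)) addnC shift.
have hi q q' : mdist (h q) (h q') = mdist q q'.
  by rewrite -(isometryE fi) !hf.
have hin n q q' : mdist (iter n h q) (iter n h q') = mdist q q'.
  by elim: n => //= n <-; rewrite hi.
exists c; split.
  move=> s t _ _; pose n := (K s + K t)%N.
  have s0 : 0 <= s + n%:R * l.
    by rewrite natrD mulrDl addrA addr_ge0// mulr_ge0// ltW.
  have t0 : 0 <= t + n%:R * l.
    by rewrite /n addnC natrD mulrDl addrA addr_ge0// mulr_ge0// ltW.
  rewrite (cE _ _ s0) (cE _ _ t0) hin kray//; congr (`| _ |); ring.
exists l => // t.
have e : t + l + (K t)%:R * l = t + (K t)%:R * l + l by ring.
rewrite (cE (K t) (t + l)); last by rewrite e addr_ge0// ltW.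
rewrite e -kf// /c; elim: (K t) (k _) => //= n IH q.
by rewrite -IH fh hf.
Qed.

End Axis.

(** * Projections to the sublevel sets of the displacement *)

Section Parabolic.
Context {R : realType} {X : metricType R}.
Hypotheses (X_CAT0 : CAT0 X) (X_proper : proper_space X).
Context (f : X -> X) (f_isom : is_isometry f).
Context (U : set_system nat) (U_ultra : UltraFilter U) (U_oo : \oo `<=` U).
Implicit Types (p q y z : X) (c g : R -> X) (a b s t M : R).

Lemma displacement_ulim_le (u : nat -> X) p a : u n @[n --> U] --> p ->
  (\forall n \near U, mdist (u n) (f (u n)) <= a) -> mdist p (f p) <= a.
Proof. by move=> up h; apply: mdist_ulim_le up (isometry_cvg f_isom _ up) h. Qed.

Lemma near_ultra_inv (e : R) : 0 < e -> \forall n \near U, n.+1%:R^-1 < e.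
Proof. by move=> e0; exact: (U_oo (near_infty_natSinv_lt (PosNum e0))). Qed.

Lemma nearest_point p a : (exists q, mdist q (f q) <= a) ->
  exists q, mdist q (f q) <= a /\
    forall y, mdist y (f y) <= a -> mdist p q <= mdist p y.
Proof.
move=> [q0 q0a]; pose E := [set mdist p y | y in [set y | mdist y (f y) <= a]].
have E0 : has_inf E.
  split; first by exists (mdist p q0), q0.
  by exists 0 => _ [y _ <-]; exact: mdist_ge0.
have ex n : exists y, mdist y (f y) <= a /\ mdist p y < inf E + n.+1%:R^-1.
  have n0 : 0 < n.+1%:R^-1 :> R by rewrite invr_gt0.
  by have [_ [y ya <-] h] := inf_adherent n0 E0; exists y.
have [u uP] := choice ex.
have [|q uq] := @ulim_exists _ _ U U_ultra X_proper u p (inf E + 1).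
  apply: nearW => n; have [_ h] := uP n; apply: ltW; apply: lt_le_trans h _.
  by rewrite lerD2l invf_le1// ler1n.
exists q; split.
  by apply: (displacement_ulim_le uq); apply: nearW => n; case: (uP n).
move=> y ya; apply: (@le_trans _ _ (inf E)); last first.
  by apply: ge_inf; [case: E0|exists y].
apply/ler_addgt0Pl => /= e e0; rewrite addrC.
apply: (mdist_ulim_le U_ultra (cvg_cst p) uq).
apply: filterS (near_ultra_inv e0) => n ne; have [_ h] := uP n.
apply: ltW; apply: lt_trans h _.
by rewrite ltrD2l.
Qed.

(** Moving from q towards y stays in the convex sublevel set, so it does not
decrease the distance to p to first order; Stewart's inequality turns this into
the inequality of a right or obtuse angle at q. *)
Lemma nearest_point_obtuse p q y a : mdist q (f q) <= a -> mdist y (f y) <= a ->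
  (forall z, mdist z (f z) <= a -> mdist p q <= mdist p z) ->
  mdist p q ^+ 2 + mdist q y ^+ 2 <= mdist p y ^+ 2.
Proof.
move=> qa ya near; apply/ler_addgt0Pl => /= e e0.
pose Q := mdist q y ^+ 2; have Q0 : 0 <= Q by exact: sqr_ge0.
(* Small enough for s Q to be at most e. *)
pose s : R := (1 + Q / e)^-1.
have N0 : 1 <= 1 + Q / e by rewrite lerDl divr_ge0// ltW.
have s0 : 0 < s by rewrite invr_gt0; lra.
have s01 : 0 <= s <= 1 by rewrite ltW//= invf_le1//; lra.
have h1 := stewart X_CAT0 p (geodesicP X_CAT0 q y) s01.
have h2 : mdist p q <= mdist p (segment_point q y s).
  apply: near; apply: le_trans (displacement_segment X_CAT0 f_isom _ _ s01) _.
  by case/andP: s01 => s0' s1; nra.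
have h3 : mdist p q ^+ 2 <= mdist p (segment_point q y s) ^+ 2.
  by rewrite ler_pXn2r ?nnegrE ?mdist_ge0.
have h4 : s * (mdist p q ^+ 2 + (1 - s) * Q) <= s * mdist p y ^+ 2.
  by have := le_trans h3 h1; rewrite -/Q; lra.
rewrite ler_pM2l// in h4.
suff : s * Q <= e by rewrite -/Q; lra.
rewrite /s ler_pdivrMl; last by lra.
have -> : (1 + Q / e) * e = e + Q by field; rewrite gt_eqF.
by lra.
Qed.

Hypothesis f_parabolic : parabolic f.

Definition min_displacement : R := inf [set mdist q (f q) | q in [set: X]].

Lemma min_displacement_le q : min_displacement <= mdist q (f q).
Proof.
apply: ge_inf; last by exists q.
by exists 0 => _ [y _ <-]; exact: mdist_ge0.
Qed.

(** Projections of p to sublevel sets of the displacement. They cannot stay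
bounded, for at a limit point the displacement would attain its infimum. *)
Lemma escaping_projections p : exists u : nat -> X,
  [/\ forall n, mdist (u n) (f (u n)) <= min_displacement + n.+1%:R^-1,
      forall n y, mdist y (f y) <= min_displacement + n.+1%:R^-1 ->
        mdist p (u n) ^+ 2 + mdist (u n) y ^+ 2 <= mdist p y ^+ 2 &
      escaping U p u].
Proof.
have ex n : exists q, mdist q (f q) <= min_displacement + n.+1%:R^-1 /\
    forall y, mdist y (f y) <= min_displacement + n.+1%:R^-1 ->
      mdist p q <= mdist p y.
  apply: nearest_point.
  have n0 : 0 < n.+1%:R^-1 :> R by rewrite invr_gt0.
  have E0 : has_inf [set mdist q (f q) | q in [set: X]].
    split; first by exists (mdist p (f p)), p.
    by exists 0 => _ [y _ <-]; exact: mdist_ge0.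
  by have [_ [y _ <-] h] := inf_adherent n0 E0; exists y; exact: ltW.
have [u uP] := choice ex; exists u; split.
- by move=> n; case: (uP n).
- by move=> n y ya; have [h1 h2] := uP n; exact: nearest_point_obtuse h1 ya h2.
move=> M; have [//|nM] := in_ultra_setVsetC [set n | M <= mdist p (u n)] U_ultra.
have [|q uq] := @ulim_exists _ _ U U_ultra X_proper u p M.
  by apply: filterS nM => n /negP; rewrite -ltNge => /ltW.
have qmin : mdist q (f q) <= min_displacement.
  apply/ler_addgt0Pl => /= e e0; rewrite addrC.
  apply: (displacement_ulim_le uq).
  apply: filterS (near_ultra_inv e0) => n ne; have [h _] := uP n.
  by apply: le_trans h _; rewrite lerD2l ltW.
have [nell nhyp] := f_parabolic; exfalso.
have [|//|//] := @attained_displacement _ _ X_CAT0 f q f_isom.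
by move=> y; exact: le_trans qmin (min_displacement_le y).
Qed.

(** The sublevel sets of the displacement contain the rays to fixed points that
issue from them, and these rays leave the projection of p at an obtuse angle
to p. Hence the projections and the fixed points are seen from p under an angle
of at most pi / 2. *)
Lemma parabolic_center p : exists2 x, ideal_fixed_points f x &
  forall y : ideal_boundary X, ideal_fixed_points f y -> chord_le x y (Num.sqrt 2).
Proof.
have [u [ua uobt uoo]] := escaping_projections p.
have [x ux] := tends_to_exists X_CAT0 X_proper U_ultra uoo.
exists x.
  apply: (tends_to_fixed X_CAT0 f_isom U_ultra uoo ux (M := min_displacement + 1)).
  apply: nearW => n; apply: le_trans (ua n) _.
  by rewrite lerD2l invf_le1// ler1n.
move=> y fy; pose c := ray_to p y.
have yc : val y c by exact: ray_to_val.
have c0 : c 0 = p by exact: ray_to0.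
have rc := boundary_rays yc.
have coo := escaping_ray U_ultra U_oo rc; rewrite c0 in coo.
have cy := tends_to_ray U_ultra yc; rewrite c0 in cy.
apply: (tends_to_chord X_CAT0 U_ultra _ uoo coo ux cy) => //.
apply: nearW => n; rewrite sqr_sqrtr// subrr mulr0 subr0.
have n0 : 0 <= n%:R :> R by [].
pose k := ray_to (u n) y.
have yk : val y k by exact: ray_to_val.
have k0 : k 0 = u n by exact: ray_to0.
have h1 : mdist (k n%:R) (f (k n%:R)) <= min_displacement + n.+1%:R^-1.
  apply: le_trans (displacement_ray_le X_CAT0 fy yk n0) _.
  by rewrite k0.
have h2 := uobt n _ h1.
have e1 : mdist (u n) (k n%:R) = n%:R.
  by rewrite -k0; apply: mdist_ray0 => //; exact: boundary_rays yk.
have e2 : mdist p (c n%:R) = n%:R by rewrite -c0 mdist_ray0.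
have e3 : mdist (c n%:R) (k n%:R) <= mdist p (u n).
  by apply: le_trans (boundary_mdist_le X_CAT0 yc yk n0) _; rewrite c0 k0.
have {}e3 : mdist (c n%:R) (k n%:R) ^+ 2 <= mdist p (u n) ^+ 2.
  by rewrite ler_pXn2r ?nnegrE ?mdist_ge0.
have Q := quadrilateral X_CAT0 (u n) p (c n%:R) (k n%:R).
rewrite (metric_sym (u n) p) (metric_sym (k _) (u n)) e1 e2 in Q.
rewrite e1 in h2; rewrite e2.
by lra.
Qed.

End Parabolic.

(** * Contraction to a center *)

Section Contraction.
Context {R : realType} {X : metricType R}.
Hypotheses (X_CAT0 : CAT0 X) (X_proper : proper_space X).
Context (f : X -> X) (f_isom : is_isometry f).
Implicit Types (p : X) (x y z : ideal_boundary X) (r s t : R).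

(** The neighbourhood is open in the Tits topology because points at a small
Tits distance are joined by a small chord and chords satisfy the triangle
inequality. *)
Lemma near_chord p (x : dist_space (@Td R X)) r : 0 < r ->
  \forall y \near x, chord_le x y r.
Proof.
move=> r0; pose V : set (dist_space (@Td R X)) :=
  [set y | exists2 a, a < r & chord_le x y a].
suff : nbhs x V by apply: filterS => y [a ar]; apply: chord_leW; exact: ltW.
apply: dist_space_nbhs; first by exists 0 => //; exact: chord_le_refl.
move=> y [a ar xy]; have ra : 0 < (r - a) / 2 by lra.
have [e e0 eP] := small_ideal_angle_chord X_CAT0 X_proper ra.
exists e => // z /Td_ge_ideal_angle/eP yz.
exists (a + (r - a) / 2); first by lra.
exact (chord_le_trans X_CAT0 X_proper xy yz).
Qed.

(** Pushing every point along its joins to the center. The chord estimate for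
joins makes this continuous in both variables. *)
Lemma contractible_of_center p (A : set (ideal_boundary X)) x r :
  A x -> 0 <= r <= 3 / 2 -> (forall y, A y -> chord_le x y r) ->
  (forall U y s, UltraFilter U -> \oo `<=` U -> 0 <= s <= 1 -> A y ->
    A (join U p y x s)) ->
  contractible R (A : set (dist_space (@Td R X))).
Proof.
move=> Ax /andP[r0 r32] xA Ajoin.
have [U [U_ultra U_oo]] := ultrafilter_at_infinity.
pose H (ty : R * dist_space (@Td R X)) : dist_space (@Td R X) :=
  join U p ty.2 x ty.1.
have Ach y : A y -> chord_le y x r by move=> /xA/chord_le_sym.
exists x, H; split => //.
- apply/subspace_continuousP => -[t y] [/= t01 Ay].
  apply: dist_space_cvg => e e0.
  have [r1 /andP[r10 r11] r1P] := chord_angle_small e0.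
  have r16 : 0 < r1 / 12 by rewrite divr_gt0.
  rewrite near_withinE.
  exists (ball t (r1 / 12), [set z | chord_le y z (r1 / 8)]).
    by split; [exact: nbhsx_ballx|apply: (near_chord p); rewrite divr_gt0].
  move=> [s z] [/= ts yz] [/= s01 Az].
  move: t01 s01; rewrite !in_itv/= => t01 s01.
  have r18 : 0 <= r1 / 8 by rewrite divr_ge0// ltW.
  have st0 : 0 <= `|t - s| by [].
  have ts' : `|t - s| < r1 / 12 by [].
  have J := join_chord X_CAT0 X_proper U_ultra U_oo (p := p) (Ach _ Ay) (Ach _ Az)
    r32 r18 yz t01 s01.
  set b := 4 * _ in J.
  have b0 : 0 <= b <= r1 by rewrite /b; apply/andP; split; lra.
  have b1 : b ^+ 2 <= 2 by case/andP: b0 => b0 b1; nra.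
  have b0' : 0 <= b by case/andP: b0.
  apply: le_lt_trans (Td_le X_CAT0 X_proper U_ultra U_oo p b0' b1 J) _.
  by rewrite lte_fin; exact: r1P.
- by move=> t y; rewrite in_itv/= => t01 Ay; exact: Ajoin.
- by move=> y Ay; exact: (join0 X_CAT0 X_proper U_ultra U_oo p (Ach _ Ay) r32).
- by move=> y Ay; exact: (join1 X_CAT0 X_proper U_ultra U_oo p (Ach _ Ay) r32).
Qed.

End Contraction.

Theorem theorem1p1 (R : realType) (X : metricType R) (f : X -> X)
    (X_nonempty : [set: X] !=set0)
    (X_proper : proper_space X)
    (X_CAT0 : CAT0 X)
    (X_directions : forall p : X, compact [set: space_of_directions p])
    (f_isometry : is_isometry f)
    (f_parabolic : parabolic f) :
  (metric_rad (@Td R X) (ideal_fixed_points f) <= (pi / 2)%:E)%E /\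
  contractible R (ideal_fixed_points f : set (dist_space (@Td R X))).
Proof.
have [p _] := X_nonempty.
have [U [U_ultra U_oo]] := ultrafilter_at_infinity.
have [x fx xP] := parabolic_center X_CAT0 X_proper f_isometry U_ultra U_oo f_parabolic p.
have r2 : Num.sqrt 2 ^+ 2 = 2 :> R by rewrite sqr_sqrtr.
split.
  apply: ge_ereal_inf; exists (ereal_sup [set Td x y | y in ideal_fixed_points f]).
    by exists x.
  apply: ge_ereal_sup => _ [y fy <-].
  have r2' : Num.sqrt 2 ^+ 2 <= 2 :> R by rewrite r2.
  apply: le_trans (Td_le X_CAT0 X_proper U_ultra U_oo p (sqrtr_ge0 _) r2' (xP y fy)) _.
  by rewrite r2 divff// subrr acos0.
have r32 : Num.sqrt 2 <= 3 / 2 :> R.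
  by rewrite -(@ler_pXn2r _ 2) ?nnegrE ?sqrtr_ge0// r2; lra.
apply: (@contractible_of_center R X X_CAT0 X_proper p _ x (Num.sqrt 2)) => //.
  by rewrite sqrtr_ge0.
move=> V y s V_ultra V_oo s01 fy.
exact: (join_fixed X_CAT0 X_proper f_isometry V_ultra V_oo p
  (chord_le_sym (xP y fy)) r32 s01 fy fx).
Qed.
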